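(* Let $q$ be a power of an odd prime $p$, let $v\ge0$, and let $m=p^vn$ with $n=2^{e_0}p_1^{e_1}\cdots p_s^{e_s}$, where $p_1,\dots,p_s$ are distinct odd primes different from $p$ and $e_0,e_1,\dots,e_s$ are positive integers; let $n'=p_1^{e_1}\cdots p_s^{e_s}$ and let $\eta$ be a primitive root system modulo $n'$. Then all the cyclic codes of length $m$ over $\mathbb{F}_q$ are given by $$C_\Omega=\left(\prod_{(y,x)\in\Sigma^+(n';q)}\prod_{d=0}^{e_0}\prod_{t\in\{0,1\}^{s_{y,d}^+}}M_{\mu(y,x)_{d,t}^+,q}(X)^{\Omega(y,x)_{d,t}^+}\times\prod_{(y,x)\in\Sigma^-(n';q)}\prod_{d=0}^{e_0}\prod_{t\in\{0,1\}^{s_{y,d}^-}}M_{\mu(y,x)_{d,t}^-,q}(X)^{\Omega(y,x)_{d,t}^-}\right)$$ for all choices of integers $0\le\Omega(y,x)_{d,t}^+,\Omega(y,x)_{d,t}^-\le p^v$, where $$M_{\mu(y,x)_{d,t}^+,q}(X)=\sum_{i=0}^{\omega_y}(-1)^{\omega_y-i}\Big(\sum_{\substack{U\subseteq\{0,\dots,\omega_y-1\}\\|U|=\omega_y-i}}\prod_{u\in U}\zeta_{r(y,x)_{d,t}^+}^{\widetilde{\mu}(y,x)_{d,t}^+q^u}\Big)X^{h(y,x)_{d,t}^+\cdot i}$$ and $$M_{\mu(y,x)_{d,t}^-,q}(X)=\sum_{i=0}^{\omega_y'}(-1)^{\omega_y'-i}\Big(\sum_{\substack{U\subseteq\{0,\dots,\omega_y'-1\}\\|U|=\omega_y'-i}}\prod_{u\in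 U}\zeta_{r(y,x)_{d,t}^-}^{\widetilde{\mu}(y,x)_{d,t}^-q^u}\Big)X^{h(y,x)_{d,t}^-\cdot i}.$$
   Context: A cyclic code of length $m$ over $\mathbb{F}_q$ is an $\mathbb{F}_q$-subspace of $\mathbb{F}_q^m$ stable under the cyclic shift $(c_0,\dots,c_{m-1})\mapsto(c_{m-1},c_0,\dots,c_{m-2})$; via $(c_0,\dots,c_{m-1})\leftrightarrow\sum c_iX^i$ it is identified with an ideal of $\mathbb{F}_q[X]/(X^m-1)$, and $(f(X))$ denotes the ideal generated by $f$. A compatible family $\{\zeta_N:\gcd(N,q)=1\}$ is fixed, where $\zeta_N$ is a primitive $N$-th root of unity in an algebraic closure of $\mathbb{F}_q$ and $\zeta_N^{N/M}=\zeta_M$ whenever $M\mid N$. $v_\ell$ is the $\ell$-adic valuation; $\mathrm{ord}_N(q)$ is the multiplicative order, $\mathrm{ord}_1(q)=1$. An $s$-tuple $\eta=(\eta_1,\dots,\eta_s)$ of integers is a primitive root system modulo $n'=p_1^{e_1}\cdots p_s^{e_s}$ if for every $i$: $\eta_i$ is a primitive root modulo $p_i^{d}$ for all $d\ge1$, and $\eta_i\equiv1\pmod{p_j^{e_j}}$ for every $j\ne i$. For $0\le y_i\le e_i$ put $f_{i,y_i}=\mathrm{ord}_{p_i^{e_i-y_i}}(q)$, $g_{i,y_i}=\phi(p_i^{e_i-y_i})/f_{i,y_i}$. $\Sigma(n';q)$ is the set of $2s$-tuples of integers $(y,x)=(y_1,\dots,y_s,x_1,\dots,x_s)$ with $0\le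 y_i\le e_i$ and $0\le x_i\le g_{i,y_i}\gcd(\mathrm{lcm}(f_{1,y_1},\dots,f_{i-1,y_{i-1}}),f_{i,y_i})-1$ for all $i$ (for $i=1$ the gcd is understood to be $1$). $\eta^{(y,x)}=\eta_1^{x_1}\cdots\eta_s^{x_s}p_1^{y_1}\cdots p_s^{y_s}$; $\tau_y=\mathrm{lcm}(f_{1,y_1},\dots,f_{s,y_s})$; $m_{y_i}=\min\{e_i-y_i,1\}$; $\omega_y=\mathrm{lcm}(\mathrm{ord}_{p_1^{m_{y_1}}}(q),\dots,\mathrm{ord}_{p_s^{m_{y_s}}}(q))$; $M_{y_i}=\max\{e_i-y_i-v_{p_i}(q^{\omega_y}-1),0\}$. Write $P_y=p_1^{e_1-y_1-M_{y_1}}\cdots p_s^{e_s-y_s-M_{y_s}}$ and $Q_y=p_1^{M_{y_1}}\cdots p_s^{M_{y_s}}$. $\Sigma^+(n';q)$ (resp. $\Sigma^-(n';q)$) is the set of $(y,x)\in\Sigma(n';q)$ with $q^{\tau_y}\equiv1$ (resp. $3$) $\pmod4$. For an integer $\gamma$, $\varphi_{n'}(\gamma)=\sum_{k\ge0}\phi_{n',k}(\gamma)2^k$, $\phi_{n',k}(\gamma)\in\{0,1\}$, is the unique formal $2$-adic power series with $2^{i+1}\mid\gamma+n'\sum_{k=0}^i\phi_{n',k}(\gamma)2^k$ for all $i\ge0$; for $d\ge0$, $U_d(\gamma)=\sum_{k=0}^{d-1}\phi_{n',k}(\gamma)2^k+(1-\phi_{n',d}(\gamma))2^d$. For $(y,x)\in\Sigma^+(n';q)$,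 $0\le d\le e_0$: $v^+(y)=v_2(q^{\tau_y}-1)$, $s_{y,d}^+=\min\{e_0-d-1,v^+(y)-1\}$; for $t\in\{0,1\}^{s_{y,d}^+}$: $\mu(y,x)_{d,t}^+=\eta^{(y,x)}+n'(U_d(\eta^{(y,x)})+\sum_{j=1}^{s_{y,d}^+}t_j2^{d+j})$, $\widetilde{\mu}(y,x)_{d,t}^+=\mu(y,x)_{d,t}^+/(2^dp_1^{y_1}\cdots p_s^{y_s})$, $r(y,x)_{d,t}^+=2^{\min\{e_0-d,v^+(y)\}}P_y$, $h(y,x)_{d,t}^+=2^{\max\{e_0-d-v^+(y),0\}}Q_y$. For $(y,x)\in\Sigma^-(n';q)$, $0\le d\le e_0$: $v^-(y)=v_2(q^{\tau_y}+1)$, $s_{y,d}^-=\min\{e_0-d-2,v^-(y)-1\}$; $\omega_y'=2\omega_y$ if $d\le e_0-3$ and $\omega_y'=\omega_y$ if $e_0-2\le d\le e_0$; for $t\in\{0,1\}^{s_{y,d}^-}$: $\mu(y,x)_{d,t}^-=\eta^{(y,x)}+n'(U_d(\eta^{(y,x)})+\sum_{j=1}^{s_{y,d}^-}t_j2^{d+j+1})$, $\widetilde{\mu}(y,x)_{d,t}^-=\mu(y,x)_{d,t}^-/(2^dp_1^{y_1}\cdots p_s^{y_s})$; $r(y,x)_{d,t}^-=2^{\min\{e_0-d,v^-(y)+1\}}P_y$ if $d\le e_0-3$, $2P_y$ if $d\in\{e_0-2,e_0-1\}$, $P_y$ if $d=e_0$; $h(y,x)_{d,t}^-=2^{\max\{e_0-d-v^-(y)-1,0\}}Q_y$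 if $d\le e_0-3$, $2Q_y$ if $d=e_0-2$, $Q_y$ if $d\in\{e_0-1,e_0\}$. When $s_{y,d}^{\pm}\le0$, $\{0,1\}^{s_{y,d}^\pm}$ is the one-element set $\{0\}$ and the sums over $j$ are empty. *)

(* Defs.v *)
From HB Require Import structures.
From mathcomp Require Import all_boot all_order all_algebra cyclic zify.

Set Implicit Arguments.
Unset Strict Implicit.
Unset Printing Implicit Defensive.

Import GRing.Theory.
Local Open Scope ring_scope.

(* Least k > 0 with a ^ k = 1 mod N.  Searching 1 .. N is enough when a is    *)
(* prime to N, since totient N <= N (see mordP); mord 1 a = 1.  The value is  *)
(* N.+1 when no such k exists.                                                *)
Definition mord (N : nat) (a : int) : nat :=
  (find (fun k => (a ^+ k.+1 == 1 %[mod N%:Z])%Z) (iota 0 N)).+1.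

Lemma mordP (N : nat) (a : int) : (0 < N)%N -> coprimez N%:Z a ->
  [/\ (0 < mord N a)%N, (a ^+ mord N a = 1 %[mod N%:Z])%Z &
      forall k : nat, (0 < k)%N -> (a ^+ k = 1 %[mod N%:Z])%Z ->
                      (mord N a <= k)%N].
Proof.
move=> N_gt0 co_aN; split=> //.
- set P := fun k => (a ^+ k.+1 == 1 %[mod N%:Z])%Z.
  have hasP : has P (iota 0 N).
    apply/hasP; exists (totient N).-1.
      rewrite mem_iota /= add0n prednK ?totient_gt0 //.
      rewrite totient_count_coprime.
      apply: (@leq_trans (\sum_(0 <= d < N) 1)%N).
        by apply: leq_sum => i _; exact: leq_b1.
      by rewrite sum_nat_const_nat muln1 subn0.
    rewrite /P prednK ?totient_gt0 //.
    have N_neq0 : N%:Z != 0 by rewrite eqz_nat -lt0n.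
    have a_ge0 := modz_ge0 a N_neq0.
    have [b Db] : exists b : nat, (a %% N%:Z)%Z = b%:Z.
      by exists `|(a %% N%:Z)%Z|%N; rewrite gez0_abs.
    have co_bN : coprime b N.
      rewrite coprime_sym -[coprime _ _]/(coprimez N%:Z b%:Z) -Db.
      by rewrite /coprimez gcdz_modr.
    rewrite -modzXm Db -[b%:Z]natz -natrX natz -[1]/(1%N%:Z) !modz_nat.
    by rewrite (Euler_exp_totient co_bN).
  have := nth_find 0%N hasP; rewrite /P nth_iota ?add0n; last first.
    by move: hasP; rewrite has_find size_iota.
  by move/eqP.
- case=> // k _ /eqP Pk; rewrite /mord ltnS.
  case: (ltnP k N) => [kN|Nk]; last first.
    by apply: leq_trans Nk; rewrite -[X in (_ <= X)%N](size_iota 0) find_size.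
  rewrite leqNgt; apply/negP=> /(before_find 0%N).
  by rewrite nth_iota // add0n Pk.
Qed.

Definition primitive_root_mod (N : nat) (a : int) : Prop :=
  coprimez N%:Z a /\ mord N a = totient N.

Definition primitive_root_system (s : nat) (pr e : 'I_s -> nat)
    (eta : 'I_s -> int) : Prop :=
  forall i : 'I_s,
    (forall d : nat, (0 < d)%N -> primitive_root_mod (pr i ^ d)%N (eta i)) /\
    (forall j : 'I_s, j != i -> (eta i = 1 %[mod (pr j ^ e j)%N%:Z])%Z).

Definition compatible_roots (K : fieldType) (q : nat) (zeta : nat -> K) : Prop :=
  (forall N : nat, coprime N q -> N.-primitive_root (zeta N)) /\
  (forall M N : nat, coprime N q -> (M %| N)%N ->
     zeta N ^+ (N %/ M)%N = zeta M).

Section AdicDigits.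

Variables (n' : nat) (gamma : int).

(* The sum of phi_k 2^k over k < i, where phi_k is the bit that makes         *)
(* 2^(k+1) divide gamma + n' (adic_partial k + phi_k 2^k); see adic_digitP    *)
(* and adic_digit_unique.                                                     *)
Fixpoint adic_partial (i : nat) : int :=
  if i is j.+1 then
    adic_partial j +
    (~~ (2 ^+ j.+1 %| gamma + n'%:Z * adic_partial j)%Z : nat)%:Z * 2 ^+ j
  else 0.

Definition adic_digit (i : nat) : bool :=
  ~~ (2 ^+ i.+1 %| gamma + n'%:Z * adic_partial i)%Z.

Lemma adic_partialE (i : nat) :
  adic_partial i = \sum_(k < i) (adic_digit k : nat)%:Z * 2 ^+ k.
Proof. by elim: i => [|i IH]; rewrite ?big_ord0 // big_ord_recr /= -IH. Qed.

Lemma adic_step (j : nat) (S : int) (b : bool) : odd n' ->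
    (2 ^+ j %| gamma + n'%:Z * S)%Z ->
  (2 ^+ j.+1 %| gamma + n'%:Z * (S + (b : nat)%:Z * 2 ^+ j))%Z
    = (b != (2 ^+ j.+1 %| gamma + n'%:Z * S)%Z).
Proof.
move=> odd_n' /dvdzP[c Dc].
have n0 : (2 : int) ^+ j != 0 by rewrite expf_neq0.
rewrite mulrDr addrA !Dc mulrA -mulrDl exprS !dvdz_mul2r //.
case: b => /=; rewrite ?mulr1 ?mulr0 ?addr0; lia.
Qed.

Lemma adic_digitP : odd n' -> forall i : nat,
  (2 ^+ i.+1 %|
     gamma + n'%:Z * \sum_(k < i.+1) (adic_digit k : nat)%:Z * 2 ^+ k)%Z.
Proof.
move=> odd_n' i; rewrite -adic_partialE.
suff H (j : nat) : (2 ^+ j %| gamma + n'%:Z * adic_partial j)%Z by apply: H.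
elim: j => [|j IH]; first by rewrite expr0 dvd1z.
by rewrite /= adic_step //; case: (_ %| _)%Z.
Qed.

Lemma adic_digit_unique (phi : nat -> bool) : odd n' ->
  (forall i : nat,
     (2 ^+ i.+1 %| gamma + n'%:Z * \sum_(k < i.+1) (phi k : nat)%:Z * 2 ^+ k)%Z) ->
  phi =1 adic_digit.
Proof.
move=> odd_n' phiP.
have phiP' (i : nat) :
    (2 ^+ i %| gamma + n'%:Z * \sum_(k < i) (phi k : nat)%:Z * 2 ^+ k)%Z.
  by case: i => [|i]; [rewrite expr0 dvd1z | apply: phiP].
have step (i : nat) :
    \sum_(k < i) (phi k : nat)%:Z * 2 ^+ k = adic_partial i ->
    phi i = adic_digit i.
  move=> E; have := phiP i; rewrite big_ord_recr /= adic_step ?phiP' // E.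
  by rewrite /adic_digit; case: (phi i); case: (_ %| _)%Z.
have partialE (l : nat) :
    \sum_(k < l) (phi k : nat)%:Z * 2 ^+ k = adic_partial l.
  elim: l => [|l IH]; first by rewrite big_ord0.
  by rewrite big_ord_recr /= (step l IH) IH.
by move=> i; apply: step.
Qed.

Definition adic_U (d : nat) : int :=
  \sum_(k < d) (adic_digit k : nat)%:Z * 2 ^+ k
  + (1 - (adic_digit d : nat)%:Z) * 2 ^+ d.

End AdicDigits.

(* Throughout, the number written p_i is pr (i - 1), and likewise for the     *)
(* other families indexed by 1 <= i <= s.                                     *)
Section CosetRepresentatives.

Variables (q s : nat) (pr e : 'I_s -> nat).

Definition odd_length : nat := (\prod_(i < s) pr i ^ e i)%N.

Section Exponents.

Variable y : {dffun forall i : 'I_s, 'I_(e i).+1}.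

Definition f_ (i : 'I_s) : nat := mord (pr i ^ (e i - y i))%N q%:Z.
Definition g_ (i : 'I_s) : nat := (totient (pr i ^ (e i - y i)) %/ f_ i)%N.

Definition x_bound (i : 'I_s) : nat :=
  (g_ i * gcdn (\big[lcmn/1]_(j < s | (j < i)%N) f_ j) (f_ i))%N.

Definition tau_ : nat := \big[lcmn/1%N]_(i < s) f_ i.

Definition omega_ : nat :=
  \big[lcmn/1%N]_(i < s) mord (pr i ^ minn (e i - y i) 1)%N q%:Z.

Definition Mexp (i : 'I_s) : nat :=
  (e i - y i - logn (pr i) (q ^ omega_ - 1))%N.

Definition P_ : nat := (\prod_(i < s) pr i ^ (e i - y i - Mexp i))%N.
Definition Q_ : nat := (\prod_(i < s) pr i ^ Mexp i)%N.
Definition py_ : nat := (\prod_(i < s) pr i ^ y i)%N.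

Definition v_plus : nat := logn 2 (q ^ tau_ - 1).
Definition v_minus : nat := logn 2 (q ^ tau_ + 1).

End Exponents.

(* The dependent type of all (y, x) with 0 <= y_i <= e_i and                  *)
(* 0 <= x_i < x_bound y i.                                                    *)
Definition Sigma : finType :=
  {y : {dffun forall i : 'I_s, 'I_(e i).+1} &
     {dffun forall i : 'I_s, 'I_(x_bound y i)}}.

Definition y_of (z : Sigma) : {dffun forall i : 'I_s, 'I_(e i).+1} := tag z.
Definition x_of (z : Sigma) : {dffun forall i : 'I_s, 'I_(x_bound (y_of z) i)} :=
  tagged z.

Definition Sigma_plus : pred Sigma :=
  fun z => (q ^ tau_ (y_of z) == 1 %[mod 4])%N.
Definition Sigma_minus : pred Sigma :=
  fun z => (q ^ tau_ (y_of z) == 3 %[mod 4])%N.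

Variables (e0 : nat) (eta : 'I_s -> int).

Definition eta_ (z : Sigma) : int :=
  (\prod_(i < s) eta i ^+ x_of z i) * \prod_(i < s) (pr i)%:Z ^+ y_of z i.

(* Truncated subtraction turns every nonpositive s into 0, for which          *)
(* {ffun 'I_0 -> bool} has a single element.  The bit t_j, 1 <= j <= s, is    *)
(* the value of t at j - 1.                                                   *)
Definition s_plus (z : Sigma) (d : nat) : nat :=
  minn (e0 - d - 1) (v_plus (y_of z) - 1).
Definition s_minus (z : Sigma) (d : nat) : nat :=
  minn (e0 - d - 2) (v_minus (y_of z) - 1).

Definition mu_plus (z : Sigma) (d : nat) (t : {ffun 'I_(s_plus z d) -> bool})
    : int :=
  eta_ z + odd_length%:Z *
    (adic_U odd_length (eta_ z) d
     + \sum_(j < s_plus z d) (t j : nat)%:Z * 2 ^+ (d + j.+1)).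

Definition mu_minus (z : Sigma) (d : nat) (t : {ffun 'I_(s_minus z d) -> bool})
    : int :=
  eta_ z + odd_length%:Z *
    (adic_U odd_length (eta_ z) d
     + \sum_(j < s_minus z d) (t j : nat)%:Z * 2 ^+ (d + j.+1 + 1)).

(* The quotients are exact. *)
Definition mut_plus (z : Sigma) (d : nat) (t : {ffun 'I_(s_plus z d) -> bool})
    : int :=
  (mu_plus t %/ (2 ^ d * py_ (y_of z))%N%:Z)%Z.
Definition mut_minus (z : Sigma) (d : nat) (t : {ffun 'I_(s_minus z d) -> bool})
    : int :=
  (mu_minus t %/ (2 ^ d * py_ (y_of z))%N%:Z)%Z.

Definition r_plus (z : Sigma) (d : nat) : nat :=
  (2 ^ minn (e0 - d) (v_plus (y_of z)) * P_ (y_of z))%N.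
Definition h_plus (z : Sigma) (d : nat) : nat :=
  (2 ^ (e0 - d - v_plus (y_of z)) * Q_ (y_of z))%N.

(* The condition d <= e0 - 3 in the integers is d + 3 <= e0 in nat. *)
Definition omega'_ (z : Sigma) (d : nat) : nat :=
  (if d + 3 <= e0 then 2 * omega_ (y_of z) else omega_ (y_of z))%N.
Definition r_minus (z : Sigma) (d : nat) : nat :=
  (if d + 3 <= e0 then 2 ^ minn (e0 - d) (v_minus (y_of z) + 1) * P_ (y_of z)
   else if d == e0 then P_ (y_of z)
   else 2 * P_ (y_of z))%N.
Definition h_minus (z : Sigma) (d : nat) : nat :=
  (if d + 3 <= e0 then 2 ^ (e0 - d - v_minus (y_of z) - 1) * Q_ (y_of z)
   else if d + 2 == e0 then 2 * Q_ (y_of z)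
   else Q_ (y_of z))%N.

Section Polynomials.

Variables (K : fieldType) (zeta : nat -> K).

Definition Mpoly (w r h : nat) (mut : int) : {poly K} :=
  \sum_(i < w.+1)
     ((-1) ^+ (w - i) *
      \sum_(U : {set 'I_w} | #|U| == (w - i)%N)
         \prod_(u in U) zeta r ^ (mut * q%:Z ^+ u)) *: 'X^(h * i).

Definition M_plus (z : Sigma) (d : nat) (t : {ffun 'I_(s_plus z d) -> bool})
    : {poly K} :=
  Mpoly (omega_ (y_of z)) (r_plus z d) (h_plus z d) (mut_plus t).

Definition M_minus (z : Sigma) (d : nat) (t : {ffun 'I_(s_minus z d) -> bool})
    : {poly K} :=
  Mpoly (omega'_ z d) (r_minus z d) (h_minus z d) (mut_minus t).

(* Families of integers in [0, B].  Only the values at z in Sigma_plus, resp. *)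
(* Sigma_minus, enter [generator].                                            *)
Definition exponents_plus (B : nat) : Type :=
  forall (z : Sigma) (d : 'I_e0.+1), {ffun 'I_(s_plus z d) -> bool} -> 'I_B.+1.
Definition exponents_minus (B : nat) : Type :=
  forall (z : Sigma) (d : 'I_e0.+1), {ffun 'I_(s_minus z d) -> bool} -> 'I_B.+1.

Definition generator (B : nat)
    (Op : exponents_plus B) (Om : exponents_minus B) : {poly K} :=
  (\prod_(z : Sigma | Sigma_plus z) \prod_(d < e0.+1)
     \prod_(t : {ffun 'I_(s_plus z d) -> bool}) M_plus t ^+ Op z d t) *
  (\prod_(z : Sigma | Sigma_minus z) \prod_(d < e0.+1)
     \prod_(t : {ffun 'I_(s_minus z d) -> bool}) M_minus t ^+ Om z d t).

End Polynomials.

End CosetRepresentatives.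

Section CyclicCodes.

Variables (F : finFieldType) (m : nat).

Definition cyclic_shift (c : 'rV[F]_m) : 'rV[F]_m := \row_i c 0 (ord_pred i).

Definition cyclic_code (C : {vspace 'rV[F]_m}) : Prop :=
  forall c : 'rV[F]_m, c \in C -> cyclic_shift c \in C.

(* C is the ideal (G) of F[X]/(X^m - 1), a word c being identified with the   *)
(* class of rVpoly c, the polynomial with coefficients c_0, ..., c_(m-1).     *)
(* {poly %/ 'X^m - 1} is this quotient ring for m > 0.                        *)
Definition generated_by (C : {vspace 'rV[F]_m}) (G : {poly F}) : Prop :=
  forall c : 'rV[F]_m,
    c \in C <->
    exists a : {poly %/ ('X^m - 1)},
      in_qpoly ('X^m - 1) (rVpoly c) = a * in_qpoly ('X^m - 1) G.

End CyclicCodes.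

(* Main.v *)
(** Over the algebraic closure K the polynomial attached to an index is the
    product of the [X^h - zeta_r^(mut q^u)] for u < w.  Since r divides q^w - 1
    Frobenius permutes its factors, so it has coefficients in F; and
    since q has order w h modulo r h (lifting the exponent), its w h roots are
    exactly the Frobenius orbit of zeta_n^mu.  A monic divisor of
    (X^n - 1)^(p^v) over F is therefore built by peeling off orbits: a root
    zeta_n^c has, modulo n and up to a power of q, its exponent c among the
    integers mu.  Modulo n' this is an induction on the primes p_i, where
    q^lcm(f_1, ..., f_(i-1)) generates the subgroup of the i-th cyclic unit
    group whose index is the bound on x_i; modulo 2^e0 the remaining freedom is
    multiplication by q^tau, whose powers fill out the class of 1 modulo 2^v,
    v = v_2(q^tau - 1), when q^tau = 1 mod 4; when q^tau = 3 mod 4 those of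
    q^(2 tau) fill out the class of 1 modulo 2^(v_2(q^tau + 1) + 1).
    No two indices need to be compared, because multiplicities are bounded by
    p^v as soon as the product divides (X^n - 1)^(p^v). *)

From HB Require Import structures.
From mathcomp Require Import all_boot all_algebra all_fingroup all_field cyclic zify ring.
Require Import Defs.

Set Implicit Arguments.
Unset Strict Implicit.
Unset Printing Implicit Defensive.

Import GRing.Theory.
Local Open Scope ring_scope.

(** * Lifting the exponent *)

Lemma sum_expn_modn_pred (p x k : nat) : (0 < x)%N -> (p %| x.-1)%N ->
  ((\sum_(i < k) x ^ i)%N = k %[mod p])%N.
Proof.
move=> x0 /dvdnP[c Dx].
elim: k => [|k IH]; first by rewrite big_ord0.
rewrite big_ord_recr /= -modnDml IH modnDml -addn1 -modnDmr.
have -> : (x ^ k = 1 %[mod p])%N.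
  have -> : x = (c * p + 1)%N by lia.
  by rewrite -modnXm modnMDl modnXm exp1n.
by rewrite modnDmr.
Qed.

(** Since [p] divides [x - 1], the expansion of [(1 + (x - 1)) ^ i] stops after its linear term
    modulo [p ^ 2]; summing the linear terms produces the binomial coefficient. *)
Lemma sum_expn_modn_sqr (p x k : nat) : (0 < x)%N -> (p %| x.-1)%N ->
  ((\sum_(i < k) x ^ i)%N = k + x.-1 * 'C(k, 2) %[mod p ^ 2])%N.
Proof.
move=> x0 dvd_p.
have step i : (x ^ i = 1 + i * x.-1 %[mod p ^ 2])%N.
  elim: i => [|i IH]; first by rewrite mul0n addn0.
  case/dvdnP: dvd_p => c Dx.
  rewrite expnS -modnMmr IH modnMmr.
  have -> : (x * (1 + i * x.-1) = (i * c ^ 2) * p ^ 2 + (1 + i.+1 * x.-1))%N.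
    by rewrite -(prednK x0) /= Dx; ring.
  by rewrite modnMDl.
elim: k => [|k IH]; first by rewrite big_ord0 bin0n muln0.
rewrite big_ord_recr /= -modnDml IH modnDml -modnDmr step modnDmr.
by congr (_ %% _)%N; rewrite binS bin1; ring.
Qed.

(** [x ^ p - 1] is [x - 1] times a geometric sum, which is [p + (x - 1) 'C(p, 2)] modulo [p ^ 2].
    The last term vanishes there: for odd [p] because [p] divides ['C(p, 2)], for [p = 2] because 4
    divides [x - 1]. So the sum has valuation exactly 1. *)
Lemma logn_exp_pred_prime (p x : nat) : prime p -> (1 < x)%N ->
    (p %| x.-1)%N -> odd p || (4 %| x.-1)%N ->
  logn p (x ^ p).-1 = (logn p x.-1).+1.
Proof.
move=> pr_p x1 dvd_p odd4.
have p0 := prime_gt0 pr_p.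
rewrite predn_exp lognM; last 2 first.
- by rewrite -subn1 subn_gt0.
- by rewrite -(prednK p0) big_ord_recl addn_gt0 expn0.
rewrite -addn1; congr addn.
set S := (\sum_(i < p) _)%N.
have S0 : (0 < S)%N by rewrite /S -(prednK p0) big_ord_recl addn_gt0 expn0.
have pS : (p %| S)%N.
  by rewrite /dvdn (sum_expn_modn_pred p (ltnW x1) dvd_p) modnn.
have npS : ~~ (p ^ 2 %| S)%N.
  have E : (S = p %[mod p ^ 2])%N.
    rewrite (sum_expn_modn_sqr p (ltnW x1) dvd_p).
    suff /dvdnP[c ->] : (p ^ 2 %| x.-1 * 'C(p, 2))%N by rewrite addnC modnMDl.
    case/orP: odd4 => [odd_p|d4].
      rewrite expnS expn1 dvdn_mul // prime_dvd_bin //=.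
      by case: p pr_p odd_p {dvd_p p0 S S0 pS} => [|[|[|[]]]].
    case: (even_prime pr_p) => [->|odd_p]; first by rewrite muln1.
    rewrite expnS expn1 dvdn_mul // prime_dvd_bin //=.
    by case: p pr_p odd_p {dvd_p p0 S S0 pS d4} => [|[|[|[]]]].
  rewrite /dvdn E -/(dvdn _ _); apply/negP => /(dvdn_leq p0).
  by have := prime_gt1 pr_p; nia.
by apply/eqP; rewrite eqn_leq -pfactor_dvdn // expn1 pS andbT -ltnS ltnNge -pfactor_dvdn.
Qed.

(** Write [k = k' p ^ e] with [p] not dividing [k']. Raising to [k'] keeps the valuation, the
    geometric sum being [k'] modulo [p]; each of the [e] remaining raisings to [p] adds 1. *)
Lemma logn_exp_pred (p x k : nat) : prime p -> (1 < x)%N ->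
    (p %| x.-1)%N -> odd p || (4 %| x.-1)%N -> (0 < k)%N ->
  logn p (x ^ k).-1 = (logn p x.-1 + logn p k)%N.
Proof.
move=> pr_p x1 dvd_p odd4 k0.
have [k' nd Dk] := pfactor_coprime pr_p k0.
have k'0 : (0 < k')%N by move: k0; rewrite Dk muln_gt0 => /andP[].
have x_k' : [/\ (1 < x ^ k')%N, (p %| (x ^ k').-1)%N,
               odd p || (4 %| (x ^ k').-1)%N & logn p (x ^ k').-1 = logn p x.-1].
  split.
  - by rewrite -(exp1n k') ltn_exp2r.
  - by rewrite predn_exp dvdn_mulr.
  - by case/orP: odd4 => [->//|d4]; rewrite predn_exp dvdn_mulr ?orbT.
  rewrite predn_exp lognM; last 2 first.
  - by rewrite -subn1 subn_gt0.
  - by rewrite -(prednK k'0) big_ord_recl addn_gt0 expn0.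
  rewrite [X in (_ + X)%N]logn_coprime ?addn0 //.
  by rewrite -coprime_modr (sum_expn_modn_pred k' (ltnW x1) dvd_p) coprime_modr.
rewrite {1}Dk expnM; move: (logn p k) => e {Dk}.
case: x_k'; move: (x ^ k')%N => z z1 zp z4 <-.
elim: e => [|e IH]; first by rewrite expn0 expn1 addn0.
rewrite expnSr expnM logn_exp_pred_prime ?IH ?addnS //.
- by rewrite -(exp1n (p ^ e)) ltn_exp2r // expn_gt0 prime_gt0.
- by rewrite predn_exp dvdn_mulr.
- by case/orP: z4 => [->//|d4]; rewrite [(_ ^ _).-1]predn_exp dvdn_mulr ?orbT.
Qed.

Lemma dvdn_exp_pred (p b x k : nat) : prime p -> (1 < x)%N ->
    (p %| x.-1)%N -> odd p || (4 %| x.-1)%N -> (0 < k)%N ->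
  (p ^ b %| (x ^ k).-1)%N = (p ^ (b - logn p x.-1) %| k)%N.
Proof.
move=> pr_p x1 dvd_p odd4 k0.
have xk0 : (0 < (x ^ k).-1)%N by rewrite -subn1 subn_gt0 -(exp1n k) ltn_exp2r.
by rewrite !pfactor_dvdn // logn_exp_pred // leq_subLR.
Qed.

Lemma dvdn_pred (N x : nat) : (0 < x)%N -> (N %| x.-1)%N = (x == 1 %[mod N])%N.
Proof. by move=> x0; rewrite eqn_mod_dvd // subn1. Qed.

Lemma exp_modz_nat (N q k : nat) :
  (q%:Z ^+ k == 1 %[mod N%:Z])%Z = (q ^ k == 1 %[mod N])%N.
Proof.
by rewrite -[q%:Z]natz -natrX natz -[1]/(1%N%:Z) !modz_nat.
Qed.

(** This turns the search defining [mord] into a divisibility criterion, the form in which orders of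
    [q] are mostly handled below. *)
Lemma dvdn_mord (N q k : nat) : (0 < N)%N -> (0 < q)%N -> coprime N q ->
  (mord N q%:Z %| k)%N = (N %| (q ^ k).-1)%N.
Proof.
move=> N0 q0 co.
have [o0 /eqP] := mordP N0 (co : coprimez N%:Z q%:Z).
rewrite exp_modz_nat dvdn_pred ?expn_gt0 ?q0 // => /eqP o1 o_min.
set o := mord _ _ in o0 o1 o_min *.
have -> : (q ^ k = q ^ (k %% o) %[mod N])%N.
  rewrite {1}(divn_eq k o) expnD [(_ * o)%N]mulnC expnM -modnMml -modnXm o1.
  by rewrite modnXm exp1n modnMml mul1n.
apply/idP/idP => [/eqP->|H]; first by rewrite expn0.
rewrite /dvdn; case: posnP => // r0; have := ltn_pmod k o0; rewrite ltnNge.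
by rewrite o_min //; apply/eqP; rewrite exp_modz_nat.
Qed.

Lemma dvdn_prod_coprime (s : nat) (F : 'I_s -> nat) (k : nat) :
    (forall i j, i != j -> coprime (F i) (F j)) ->
  (\prod_(i < s) F i %| k)%N = [forall i, F i %| k]%N.
Proof.
elim: s F => [|s IH] F co.
  by rewrite big_ord0 dvd1n; apply/esym/forallP => -[].
rewrite big_ord_recl Gauss_dvd; last first.
  apply big_ind => [|x y cx cy|i _]; rewrite ?coprimen1 //.
    by rewrite coprimeMr cx.
  by apply: co; rewrite eq_sym.
rewrite IH => [|i j nij]; last by apply: co; rewrite (inj_eq lift_inj).
apply/andP/forallP => [[F0 /forallP Fl] i|H]; last by split=> //; apply/forallP.
by case: (unliftP ord0 i) => [j|] ->.
Qed.

(** In [(x - 1) (x + 1)] the first factor is 2 modulo 4. Passing to the square makes lifting at the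
    prime 2 available. *)
Lemma logn_sqr_pred (x : nat) : (1 < x)%N -> (x == 3 %[mod 4])%N ->
  logn 2 (x ^ 2).-1 = (logn 2 (x + 1)).+1.
Proof.
move=> x1 /eqP x3; have x0 : (0 < x - 1)%N by rewrite subn_gt0.
rewrite -subn1 -[X in (_ - X)%N](exp1n 2) subn_sqr.
rewrite lognM ?addn_gt0 ?orbT //.
suff -> : logn 2 (x - 1) = 1%N by [].
have d2 : (2 ^ 1 %| x - 1)%N by clear x0; lia.
have d4 : ~~ (2 ^ 2 %| x - 1)%N by clear x0; lia.
by move: d2 d4; rewrite !pfactor_dvdn //; case: logn => [|[]].
Qed.

(** * Orders of q *)

Section Orders.

Variables (q s : nat) (pr e : 'I_s -> nat).
Hypotheses (q_gt1 : (1 < q)%N) (odd_q : odd q).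
Hypotheses (pr_prime : forall i, prime (pr i)) (pr_odd : forall i, odd (pr i)).
Hypotheses (pr_inj : injective pr) (pr_q : forall i, coprime (pr i) q).

Lemma coprime_pr (i j : 'I_s) (a b : nat) :
  i != j -> coprime (pr i ^ a) (pr j ^ b).
Proof.
move=> nij; apply: coprimeXl; apply: coprimeXr; rewrite prime_coprime //.
by rewrite dvdn_prime2 // (inj_eq pr_inj).
Qed.

Section FixedExponents.

Variable y : {dffun forall i : 'I_s, 'I_(e i).+1}.

Local Notation w := (omega_ q pr y).
Local Notation Q := (Q_ q pr y).
Local Notation P := (P_ q pr y).
Local Notation tau := (tau_ q pr y).
Local Notation ae i := (e i - y i)%N.

Let q_gt0 : (0 < q)%N. Proof. exact: ltnW. Qed.

Lemma dvdn_mord_pr (i : 'I_s) (b k : nat) :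
  (mord (pr i ^ b) q%:Z %| k)%N = (pr i ^ b %| (q ^ k).-1)%N.
Proof.
rewrite dvdn_mord ?expn_gt0 ?(prime_gt0 (pr_prime i)) //; exact: coprimeXl.
Qed.

Lemma biglcmn_gt0 (F : 'I_s -> nat) : (forall i, 0 < F i)%N ->
  (0 < \big[lcmn/1%N]_(i < s) F i)%N.
Proof. by move=> F0; apply big_ind => // a b; rewrite lcmn_gt0 => -> ->. Qed.

Lemma omega_gt0 : (0 < w)%N. Proof. by apply: biglcmn_gt0. Qed.
Lemma tau_gt0 : (0 < tau)%N. Proof. by apply: biglcmn_gt0. Qed.

Lemma Q_gt0 : (0 < Q)%N.
Proof. by rewrite prodn_gt0 // => i; rewrite expn_gt0 prime_gt0. Qed.

Lemma odd_prod_pr (F : 'I_s -> nat) : odd (\prod_(i < s) pr i ^ F i).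
Proof.
apply big_ind => // [a b|i _]; last by rewrite oddX pr_odd orbT.
by rewrite oddM => -> ->.
Qed.

Lemma expq_gt1 (k : nat) : (0 < k)%N -> (1 < q ^ k)%N.
Proof. by move=> k0; rewrite -(exp1n k) ltn_exp2r. Qed.

Lemma pr_dvd_omega (i : 'I_s) : (y i < e i)%N -> (pr i %| (q ^ w).-1)%N.
Proof.
move=> ye; have -> : pr i = (pr i ^ minn (ae i) 1)%N.
  by rewrite (minn_idPr _) ?expn1 // subn_gt0.
by rewrite -dvdn_mord_pr; apply: (biglcmn_sup i).
Qed.

(** When [y i < e i], the prime [pr i] divides [q ^ w - 1], so the exponent can be lifted in base
    [q ^ W]; [Mexp] is the valuation that [k] must still supply. When [y i = e i] both prime powers
    are 1. *)
Lemma dvdn_ae_omega (W k : nat) (i : 'I_s) : (w %| W)%N -> (0 < W)%N ->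
    (0 < k)%N ->
    (0 < e i - y i -> logn (pr i) (q ^ W).-1 = logn (pr i) (q ^ w).-1)%N ->
  (pr i ^ ae i %| (q ^ (W * k)).-1)%N = (pr i ^ Mexp q pr y i %| k)%N.
Proof.
move=> /dvdnP[c DW] W0 k0 lg; rewrite /Mexp.
have [ye|] := ltnP (y i) (e i); last first.
  by rewrite -subn_eq0 => /eqP->; rewrite sub0n expn0 !dvd1n.
rewrite expnM dvdn_exp_pred ?expq_gt1 ?pr_odd //; last first.
  rewrite DW mulnC expnM predn_exp dvdn_mulr //; exact: pr_dvd_omega.
by rewrite lg ?subn_gt0 // subn1.
Qed.

(** So [w * Q] is the order of [q] modulo the product of the [pr i ^ (e i - y i)]. Reduction modulo
    the primes themselves forces [w] to divide [j]; the cofactor must then contain each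
    [pr i ^ Mexp i], and these are pairwise coprime. *)
Lemma dvdn_omega_Q (j : nat) :
  (w * Q %| j)%N = [forall i, pr i ^ ae i %| (q ^ j).-1]%N.
Proof.
have [->|j0] := posnP j.
  by rewrite dvdn0; apply/esym/forallP => i; rewrite expn0 dvdn0.
have dvdQ k : (Q %| k)%N = [forall i, pr i ^ Mexp q pr y i %| k]%N.
  by apply: dvdn_prod_coprime => i1 i2; exact: coprime_pr.
apply/idP/forallP => [/dvdnP[k Dj] i|H].
  move: j0; rewrite Dj mulnCA muln_gt0 => /andP[_ k0].
  rewrite dvdn_ae_omega ?omega_gt0 //.
  by have := dvdn_mull k (dvdnn Q); rewrite dvdQ => /forallP.
have /dvdnP[k Dj] : (w %| j)%N.
  apply/dvdn_biglcmP => i _; rewrite dvdn_mord_pr.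
  by apply: dvdn_trans (H i); rewrite dvdn_exp2l // geq_minl.
move: j0 H; rewrite Dj mulnC muln_gt0 => /andP[_ k0] H.
rewrite dvdn_pmul2l ?omega_gt0 // dvdQ.
by apply/forallP => i; rewrite -(dvdn_ae_omega (W := w)) ?omega_gt0.
Qed.

(** The lcm of the orders modulo the prime powers is the order modulo their product, which
    [dvdn_omega_Q] identifies as [w * Q]. *)
Lemma tauE : tau = (w * Q)%N.
Proof.
apply/eqP; rewrite eqn_dvd; apply/andP; split.
  apply/dvdn_biglcmP => i _; rewrite /f_ dvdn_mord_pr.
  by have := dvdnn (w * Q); rewrite {1}dvdn_omega_Q => /forallP.
rewrite dvdn_omega_Q; apply/forallP => i; rewrite -dvdn_mord_pr.
exact: (biglcmn_sup i).
Qed.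

Lemma PQ : (P * Q)%N = (\prod_(i < s) pr i ^ ae i)%N.
Proof.
rewrite -big_split /=; apply: eq_bigr => i _; rewrite -expnD.
by rewrite subnK // /Mexp leq_subr.
Qed.

Lemma dvdn_P (k : nat) :
  (P %| k)%N = [forall i, pr i ^ (ae i - Mexp q pr y i) %| k]%N.
Proof. by apply: dvdn_prod_coprime => i1 i2; exact: coprime_pr. Qed.

Lemma dvdn_PQ (k : nat) : (P * Q %| k)%N = [forall i, pr i ^ ae i %| k]%N.
Proof. by rewrite PQ; apply: dvdn_prod_coprime => i1 i2; exact: coprime_pr. Qed.

(** The exponent of [pr i] in [P] is the minimum of [e i - y i] and the valuation of [q ^ w - 1]. *)
Lemma P_dvd : (P %| (q ^ w).-1)%N.
Proof.
rewrite dvdn_P; apply/forallP => i; rewrite /Mexp.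
have [ye|] := ltnP (y i) (e i); last first.
  by rewrite -subn_eq0 => /eqP->; rewrite sub0n expn0 !dvd1n.
rewrite pfactor_dvdn ?subn1 //; last by rewrite -subn1 subn_gt0 expq_gt1 ?omega_gt0.
lia.
Qed.

Lemma odd_Q : odd Q. Proof. exact: odd_prod_pr. Qed.

Lemma expq_mod4 (k : nat) : (q ^ k = if odd k then q else 1 %[mod 4])%N.
Proof.
have q2 : (q ^ 2 = 1 %[mod 4])%N.
  by rewrite -modnXm; case: (q %% 4)%N (ltn_pmod q (isT : 0 < 4)%N) (modn2 q)
    (modn_dvdm q (isT : 2 %| 4)%N) => [|[|[|[]]]] //=; rewrite odd_q => _ ->.
rewrite -{1}(odd_double_half k) expnD -mul2n expnM -modnMmr -modnXm q2 modnXm.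
by rewrite exp1n modnMmr muln1; case: (odd k).
Qed.

(** [tau] and [w] differ by the odd factor [Q], and a power of an odd [q] modulo 4 depends only on
    the parity of the exponent. *)
Lemma expq_tau_mod4 : (q ^ tau = q ^ w %[mod 4])%N.
Proof. by rewrite !expq_mod4 tauE oddM odd_Q andbT. Qed.

(** * Orders of [q] when [q ^ tau] is 1 modulo 4 *)

Section Plus.
Hypothesis plus : (q ^ tau == 1 %[mod 4])%N.

Lemma dvd4_omega : (4 %| (q ^ w).-1)%N.
Proof. by rewrite dvdn_pred ?expn_gt0 ?q_gt0 // -expq_tau_mod4. Qed.

Lemma v_plusE : v_plus q pr y = logn 2 (q ^ w).-1.
Proof.
rewrite /v_plus tauE subn1 expnM logn_exp_pred ?expq_gt1 ?omega_gt0 ?Q_gt0 //.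
- by rewrite [X in (_ + X)%N]logn_coprime ?addn0 // coprime2n odd_Q.
- by apply: dvdn_trans dvd4_omega.
- by rewrite dvd4_omega.
Qed.

(** The odd part of the modulus forces [w * Q] to divide [j]. Since 4 divides [q ^ w - 1], lifting
    at 2 in base [q ^ w] then requires a further power of 2, which is coprime to [Q]. *)
Lemma order_plus (b j : nat) :
  (2 ^ b * (P * Q) %| (q ^ j).-1)%N -> (w * (2 ^ (b - v_plus q pr y) * Q) %| j)%N.
Proof.
have [->|j0 H] := posnP j; first by rewrite dvdn0.
have wQ : (w * Q %| j)%N.
  by rewrite dvdn_omega_Q -dvdn_PQ; apply: dvdn_trans H; rewrite dvdn_mull.
have [k Dj] := dvdnP (dvdn_trans (dvdn_mulr _ (dvdnn _)) wQ).
move: j0 wQ H; rewrite Dj mulnC muln_gt0 => /andP[_ k0].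
rewrite !dvdn_pmul2l ?omega_gt0 // => Qk H.
rewrite Gauss_dvd ?Qk ?andbT; last by rewrite coprimeXl // coprime2n odd_Q.
rewrite v_plusE -dvdn_exp_pred ?expq_gt1 ?omega_gt0 //.
- by rewrite -expnM; apply: dvdn_trans H; rewrite dvdn_mulr.
- by apply: dvdn_trans dvd4_omega.
- by rewrite dvd4_omega.
Qed.

Lemma root_order_plus (b : nat) :
  (2 ^ minn b (v_plus q pr y) * P %| (q ^ w).-1)%N.
Proof.
rewrite Gauss_dvd ?P_dvd ?andbT; last by rewrite coprimeXl // coprime2n odd_prod_pr.
rewrite pfactor_dvdn // ?v_plusE ?geq_minr //.
by rewrite -subn1 subn_gt0 expq_gt1 ?omega_gt0.
Qed.

End Plus.

(** * Orders of [q] when [q ^ tau] is 3 modulo 4 *)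

Section Minus.
Hypothesis minus : (q ^ tau == 3 %[mod 4])%N.

Lemma odd_omega : odd w.
Proof. by move: minus; rewrite expq_tau_mod4 expq_mod4; case: odd. Qed.

Lemma q_mod4 : (q = 3 %[mod 4])%N.
Proof. by move: minus; rewrite expq_tau_mod4 expq_mod4 odd_omega => /eqP. Qed.

Lemma dvd4_omega2 : (4 %| (q ^ (2 * w)).-1)%N.
Proof.
rewrite dvdn_pred ?expn_gt0 ?q_gt0 // expq_mod4.
by rewrite oddM.
Qed.

Lemma v_minus_gt1 : (1 < v_minus q pr y)%N.
Proof.
rewrite /v_minus -pfactor_dvdn ?addn1 // /dvdn -addn1 -modnDml (eqP minus).
by [].
Qed.

(** Here [q ^ w] is 3 modulo 4, so the base for lifting at 2 has to be [q ^ (2 * w)]. The odd factor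
    [Q] does not change the valuation, and at [q ^ (2 * tau)] it is given by [logn_sqr_pred]. *)
Lemma v_minusE : (v_minus q pr y).+1 = logn 2 (q ^ (2 * w)).-1.
Proof.
have L : logn 2 (q ^ (2 * tau)).-1 = logn 2 (q ^ (2 * w)).-1.
  rewrite tauE mulnA expnM logn_exp_pred ?expq_gt1 ?muln_gt0 ?omega_gt0 ?Q_gt0 //.
  - by rewrite [X in (_ + X)%N]logn_coprime ?addn0 // coprime2n odd_Q.
  - by apply: dvdn_trans dvd4_omega2.
  - by rewrite dvd4_omega2.
rewrite -L mulnC expnM logn_sqr_pred //.
exact: expq_gt1 tau_gt0.
Qed.

Lemma odd_part_minus (b j : nat) :
  (2 ^ b * (P * Q) %| (q ^ j).-1)%N -> (w * Q %| j)%N.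
Proof.
move=> H; rewrite dvdn_omega_Q -dvdn_PQ.
by apply: dvdn_trans H; rewrite dvdn_mull.
Qed.

(** Odd powers of [q] are 3 modulo 4, so [j] is even; [w * Q] being odd, the factor 2 is new. *)
Lemma even_order_minus (b j : nat) : (1 < b)%N ->
  (2 ^ b * (P * Q) %| (q ^ j).-1)%N -> (w * (2 * Q) %| j)%N.
Proof.
move=> b1 H; have d4 : (4 %| (q ^ j).-1)%N.
  apply: dvdn_trans H; rewrite dvdn_mulr //; exact: (@dvdn_exp2l 2 2).
rewrite mulnCA Gauss_dvd ?(odd_part_minus H) ?andbT; last first.
  by rewrite coprime2n oddM odd_omega odd_Q.
move: d4; rewrite dvdn_pred ?expn_gt0 ?q_gt0 // expq_mod4 dvdn2.
by case: (odd j) => //; rewrite q_mod4.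
Qed.

Lemma order_minus (b j : nat) : (1 < b)%N ->
  (2 ^ b * (P * Q) %| (q ^ j).-1)%N ->
  ((2 * w) * (2 ^ (b - v_minus q pr y - 1) * Q) %| j)%N.
Proof.
have [->|j0 b1 H] := posnP j; first by rewrite dvdn0.
have := even_order_minus b1 H; rewrite mulnCA mulnA => wQ.
have [k Dj] := dvdnP (dvdn_trans (dvdn_mulr _ (dvdnn _)) wQ).
move: j0 wQ H; rewrite Dj mulnC muln_gt0 => /andP[w0 k0].
rewrite !dvdn_pmul2l // => Qk H.
rewrite Gauss_dvd ?Qk ?andbT; last by rewrite coprimeXl // coprime2n odd_Q.
rewrite -subnDA addn1 v_minusE -dvdn_exp_pred ?expq_gt1 //.
- by rewrite -expnM; apply: dvdn_trans H; rewrite dvdn_mulr.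
- by apply: dvdn_trans dvd4_omega2.
- by rewrite dvd4_omega2.
Qed.

Lemma root_order_minus (b : nat) :
  (2 ^ minn b (v_minus q pr y + 1) * P %| (q ^ (2 * w)).-1)%N.
Proof.
rewrite Gauss_dvd; last by rewrite coprimeXl // coprime2n odd_prod_pr.
apply/andP; split; last first.
  by rewrite mulnC expnM predn_exp; apply: dvdn_mulr; exact: P_dvd.
rewrite pfactor_dvdn // ?addn1 ?v_minusE ?geq_minr //.
by rewrite -subn1 subn_gt0 expq_gt1 // muln_gt0 omega_gt0.
Qed.

End Minus.
End FixedExponents.

Section Indices.
Variable e0 : nat.

(** These are the facts that [orbit_polyP] asks of [r] and [h]: [r * h] is the order of the chosen
    root, [q ^ w] acts trivially on the [r]-th roots of unity, and the Frobenius orbit of the root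
    has at least [w * h] elements. *)
Lemma plus_orders (z : Sigma q pr e) (d : nat) : Sigma_plus z -> (d <= e0)%N ->
  [/\ (r_plus e0 z d * h_plus e0 z d
        = 2 ^ (e0 - d) * \prod_(i < s) pr i ^ (e i - y_of z i))%N,
      (r_plus e0 z d %| (q ^ omega_ q pr (y_of z)).-1)%N &
      forall j, (r_plus e0 z d * h_plus e0 z d %| (q ^ j).-1)%N ->
        (omega_ q pr (y_of z) * h_plus e0 z d %| j)%N].
Proof.
move=> zp de; have rh : (r_plus e0 z d * h_plus e0 z d
    = 2 ^ (e0 - d) * (P_ q pr (y_of z) * Q_ q pr (y_of z)))%N.
  rewrite /r_plus /h_plus mulnACA -expnD; congr (2 ^ _ * _)%N; lia.
split=> [||j]; first by rewrite rh PQ.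
  exact: root_order_plus.
by rewrite rh; exact: order_plus.
Qed.

(** The branches follow the 2-part [2 ^ (e0 - d)] of the modulus. From 8 on, the even order of [q]
    is accounted for by the doubled [omega'_]; for 4 by the factor 2 in [h]; for 2 and 1 the order
    modulo the 2-part is 1. *)
Lemma minus_orders (z : Sigma q pr e) (d : nat) : Sigma_minus z -> (d <= e0)%N ->
  [/\ (r_minus e0 z d * h_minus e0 z d
        = 2 ^ (e0 - d) * \prod_(i < s) pr i ^ (e i - y_of z i))%N,
      (r_minus e0 z d %| (q ^ omega'_ e0 z d).-1)%N &
      forall j, (r_minus e0 z d * h_minus e0 z d %| (q ^ j).-1)%N ->
        (omega'_ e0 z d * h_minus e0 z d %| j)%N].
Proof.
move=> zm de.
have rh : (r_minus e0 z d * h_minus e0 z d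
    = 2 ^ (e0 - d) * (P_ q pr (y_of z) * Q_ q pr (y_of z)))%N.
  have v1 := v_minus_gt1 zm.
  rewrite /r_minus /h_minus; case: leqP => d3.
    rewrite mulnACA -expnD; congr (2 ^ _ * _)%N; lia.
  case: eqP => [->|nd]; first by rewrite subnn mul1n ifN //; lia.
  case: eqP => [<-|nd2]; first by rewrite addKn mulnACA.
  by rewrite (_ : e0 - d = 1)%N ?expn1 ?mulnA //; lia.
split=> [||j]; first by rewrite rh PQ.
- rewrite /r_minus /omega'_; case: leqP => d3; first exact: root_order_minus.
  have := P_dvd (y_of z) => dP; case: eqP => // _.
  rewrite Gauss_dvd ?dP ?andbT; last by rewrite coprime2n odd_prod_pr.
  rewrite dvdn_pred ?expn_gt0 ?(ltnW q_gt1) //.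
  by rewrite !modn2 oddX odd_q orbT.
- rewrite rh /h_minus /omega'_; case: leqP => d3.
    by apply: order_minus => //; lia.
  case: eqP => [<-|nd]; first by rewrite addKn; apply: even_order_minus.
  exact: odd_part_minus.
Qed.

End Indices.
End Orders.

(** * Coverage of the residues modulo n *)

Lemma intr_Zp_eq0 (N : nat) (z : int) : (1 < N)%N ->
  ((z%:~R : 'Z_N) == 0) = (N%:Z %| z)%Z.
Proof.
move=> N1.
have nat_case (n : nat) : ((n%:R : 'Z_N) == 0) = (N%:Z %| n%:Z)%Z.
  by rewrite -val_eqE /= val_Zp_nat.
case: z => n; first by rewrite -pmulrn nat_case.
by rewrite NegzE mulrNz oppr_eq0 rpredN -pmulrn nat_case.
Qed.

(** The units modulo [N] form the cyclic group generated by [g], in which the powers of [q ^ L] are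
    a subgroup whose index [K] is the bound on [x]. That subgroup is generated by [g ^ K], so
    multiplying by a power of [q ^ L] reduces the exponent of [g] modulo [K]. *)
Lemma primitive_root_cover (N : nat) (g c : int) (q L : nat) :
    (0 < N)%N -> (0 < q)%N -> coprime N q ->
    coprimez N%:Z g -> mord N g = totient N -> coprimez N%:Z c ->
  exists x j : nat, (x < (totient N %/ mord N q%:Z) * gcdn L (mord N q%:Z))%N /\
    (N%:Z %| c * q%:Z ^+ (L * j) - g ^+ x)%Z.
Proof.
move=> N0 q0 co_q co_g ord_g co_c.
have [N1|N1|N1] := ltngtP N 1; first by case: N N1 N0 {co_q co_g ord_g co_c}.
  have unit_int z : coprimez N%:Z z -> (z%:~R : 'Z_N) \is a GRing.unit.
    move=> co_z; have [n Dn] : exists n : nat, (z %% N%:Z)%Z = n%:Z.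
      by exists `|(z %% N%:Z)%Z|%N; rewrite gez0_abs // modz_ge0 // -lt0n.
    have -> : z%:~R = n%:R :> 'Z_N.
      apply/eqP; rewrite -subr_eq0 pmulrn -intrB intr_Zp_eq0 //.
      by rewrite -eqz_mod_dvd -Dn modz_mod.
    rewrite unitZpE //.
    by rewrite -[coprime _ _]/(coprimez N%:Z n%:Z) -Dn /coprimez gcdz_modr.
  have int_eq (z1 z2 : int) :
      ((z1%:~R : 'Z_N) == z2%:~R) = (N%:Z %| z1 - z2)%Z.
    by rewrite -subr_eq0 -intrB intr_Zp_eq0.
  pose U z (co : coprimez N%:Z z) : {unit 'Z_N} :=
    FinRing.unit 'Z_N (unit_int z co).
  pose ug := U g co_g; pose uc := U c co_c; pose uq := U q%:Z co_q.
  have [_ _ g_min] := mordP N0 co_g.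
  have cU : #|[set: {unit 'Z_N}]| = totient N := card_units_Zp N0.
  have full : [set: {unit 'Z_N}] = <[ug]>%g.
    apply/esym/eqP; rewrite eqEcard subsetT /= -/(order ug).
    rewrite cU -ord_g.
    apply: g_min; first exact: order_gt0.
    apply/eqP; rewrite eqz_mod_dvd -int_eq rmorphXn /=.
    have := congr1 val (expg_order ug); rewrite FinRing.val_unitX /= => ->.
    by rewrite mulr1z.
  have mem_g x : x \in <[ug]>%g by rewrite -full inE.
  have ord_q : #[uq]%g = mord N q%:Z.
    apply/eqP; rewrite eqn_dvd order_dvdn -val_eqE FinRing.val_unitX /= dvdn_mord //.
    have E k : ((q%:Z%:~R : 'Z_N) ^+ k == 1) = (N %| (q ^ k).-1)%N.
      rewrite -rmorphXn /= -[1]/(1%:~R : 'Z_N) int_eq dvdn_pred ?expn_gt0 ?q0 //.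
      by rewrite -exp_modz_nat eqz_mod_dvd.
    rewrite E -dvdn_mord // dvdnn -E /=.
    by have := congr1 val (expg_order uq); rewrite FinRing.val_unitX /= => ->.
  have card_g : #[ug]%g = totient N by rewrite -cU full.
  pose w := (uq ^+ L)%g; pose K := (#[ug]%g %/ #[w]%g)%N.
  have w_g : (#[w]%g %| #[ug]%g)%N by rewrite card_g -cU order_dvdG // inE.
  have K0 : (0 < K)%N by rewrite divn_gt0 ?order_gt0 // dvdn_leq ?order_gt0.
  have DK : K = (totient N %/ mord N q%:Z * gcdn L (mord N q%:Z))%N.
    have q_g : (#[uq]%g %| #[ug]%g)%N by rewrite card_g -cU order_dvdG // inE.
    rewrite /K orderXgcd -ord_q -card_g [gcdn L _]gcdnC.
    have [a Da] := dvdnP q_g; rewrite Da mulnK ?order_gt0 //.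
    have [b Db] := dvdnP (dvdn_gcdl #[uq]%g L).
    have gt0 : (0 < gcdn #[uq]%g L)%N by rewrite gcdn_gt0 order_gt0.
    have b0 : (0 < b)%N by have := order_gt0 uq; rewrite Db muln_gt0 => /andP[].
    by rewrite {1 2}Db mulnK // mulnCA mulKn.
  (* A cyclic group has one subgroup of each order, so comparing orders is enough. *)
  have gK : <[ug ^+ K]>%g = <[w]>%g.
    apply/eqP; rewrite (eq_subG_cyclic (cycle_cyclic ug)) ?cycle_subG ?mem_cycle //.
      have w0 : (0 < #[w]%g)%N := order_gt0 w.
      rewrite -![#|_|]/(order _) orderXdiv /K ?dvdn_div // -{1}(divnK w_g).
      by rewrite mulKn.
  have /cycleP[k Dk] : uc \in <[ug]>%g by exact: mem_g.
  have : ((ug ^+ K) ^- (k %/ K) \in <[w]>)%g 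
    by rewrite groupV; have := mem_cycle (ug ^+ K)%g (k %/ K); rewrite gK.
  case/cycleP=> j Dj; exists (k %% K)%N, j; split; first by rewrite -DK ltn_mod.
  rewrite -int_eq rmorphM !rmorphXn /=.
  have /(congr1 val) : (uc * uq ^+ (L * j) = ug ^+ (k %% K))%g.
    rewrite expgM -Dj Dk {1}(divn_eq k K) [(_ * K + _)%N]addnC expgD.
    by rewrite [(_ * K)%N]mulnC expgM mulgK.
  by rewrite /= !FinRing.val_unitX /= => ->.
(* The case [N = 1] stands apart because ['Z_1] is not the zero ring. *)
exists 0%N, 0%N; rewrite N1 dvd1z; split=> //.
suff -> : mord 1 q%:Z = 1%N by rewrite gcdn1.
by rewrite /mord /= !modz1.
Qed.

Lemma adic_partial_dvd (n' : nat) (g : int) (d : nat) : odd n' ->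
  (2 ^+ d %| g + n'%:Z * adic_partial n' g d)%Z.
Proof.
move=> odd_n'; case: d => [|d]; first by rewrite expr0 dvd1z.
by rewrite adic_partialE; exact: adic_digitP.
Qed.

(** [adic_U] takes the right digits below [d] and the wrong one at [d], so divisibility stops
    exactly at [2 ^ d]. *)
Lemma adic_U_exact (n' : nat) (g : int) (d : nat) : odd n' ->
  (2 ^+ d %| g + n'%:Z * adic_U n' g d)%Z /\
  ~~ (2 ^+ d.+1 %| g + n'%:Z * adic_U n' g d)%Z.
Proof.
move=> odd_n'; have H := adic_partial_dvd g d odd_n'.
have -> : adic_U n' g d
    = adic_partial n' g d + (~~ adic_digit n' g d : nat)%:Z * 2 ^+ d.
  by rewrite /adic_U -adic_partialE; case: adic_digit.
split; last by rewrite adic_step // /adic_digit; case: (_ %| _)%Z.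
by rewrite mulrDr addrA rpredD // mulrA dvdz_mull.
Qed.

Lemma exp2z (k : nat) : (2 ^ k)%N%:Z = 2 ^+ k.
Proof. by rewrite -natz natrX natz. Qed.

(** One bit is gained at a time: if [c A ^ j] agrees with [m] modulo [2 ^ (v + l)] but no further,
    the factor [A ^ (2 ^ l)], which is 1 plus an odd multiple of [2 ^ (v + l)], corrects the next
    bit. *)
Lemma cycle_mod2 (A b v : nat) (c m : int) : (1 < A)%N -> (4 %| A.-1)%N ->
    v = logn 2 A.-1 -> ~~ (2 %| m)%Z -> (2 ^+ minn b v %| c - m)%Z ->
  exists j, (2 ^+ b %| c * A%:Z ^+ j - m)%Z.
Proof.
move=> A1 A4 Dv odd_m.
have [bv H|vb H] := leqP b v; first by exists 0%N; rewrite expr0 mulr1.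
rewrite -(subnKC (ltnW vb)); elim: (b - v)%N => [|l [j IH]].
  by exists 0%N; rewrite expr0 mulr1 addn0.
case/dvdzP: IH => x Dx; have [even_x|odd_x] := boolP (2 %| x)%Z.
  by exists j; rewrite Dx addnS exprS; apply: dvdz_mul.
have v2 : (1 < v)%N.
  by rewrite Dv -pfactor_dvdn // -subn1 subn_gt0.
have A2l : (1 < A ^ 2 ^ l)%N by rewrite -{1}(exp1n (2 ^ l)) ltn_exp2r // expn_gt0.
have lgA : logn 2 (A ^ 2 ^ l).-1 = (v + l)%N.
  rewrite logn_exp_pred ?expn_gt0 ?A4 ?orbT //; last by apply: dvdn_trans A4.
  by rewrite -Dv pfactorK.
have [a na Da] : exists2 a : int, ~~ (2 %| a)%Z &
    (A%:Z ^+ (2 ^ l)%N) = 1 + a * 2 ^+ (v + l).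
  have /(pfactor_coprime (isT : prime 2))[a co_a Da] : (0 < (A ^ 2 ^ l).-1)%N.
    by rewrite -subn1 subn_gt0.
  exists a%:Z; first by move: co_a; rewrite coprime2n -[(2 %| _)%Z]/(2 %| a)%N dvdn2 negbK.
  rewrite -[A%:Z]natz -natrX natz -exp2z -lgA -PoszM -Da; lia.
exists (j + 2 ^ l)%N; rewrite exprD mulrA Da mulrDr mulr1.
have -> : c * A%:Z ^+ j = x * 2 ^+ (v + l) + m by rewrite -Dx subrK.
set w := (2 : int) ^+ (v + l).
have -> : x * w + m + (x * w + m) * (a * w) - m = (x + a * m + a * x * w) * w.
  by ring.
(* The first factor must be even: [x + a * m] is a sum of two odd numbers, and [w] is even. *)
rewrite addnS exprS dvdz_mul2r ?expf_neq0 //.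
have nam : ~~ (2 %| a * m)%Z.
  by rewrite dvdzE abszM Euclid_dvdM // negb_or; apply/andP.
have H1 : (2 %| x + a * m)%Z.
  move: (a * m) nam odd_x => am; clear; lia.
apply: rpredD => //.
by rewrite /w; case: (v) v2 => // v' _; rewrite addSn exprS mulrCA dvdz_mulr.
Qed.

(** * Residues modulo the odd part of the length *)

Section Coverage.

Variables (q s : nat) (pr e : 'I_s -> nat).
Hypotheses (q_gt1 : (1 < q)%N) (odd_q : odd q).
Hypotheses (pr_prime : forall i, prime (pr i)) (pr_odd : forall i, odd (pr i)).
Hypotheses (pr_inj : injective pr) (pr_q : forall i, coprime (pr i) q).
Variable eta : 'I_s -> int.
Hypothesis etaP : primitive_root_system pr e eta.

Let q_gt0 : (0 < q)%N. Proof. exact: ltnW. Qed.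
Local Notation n' := (odd_length pr e).

Lemma odd_odd_length : odd n'. Proof. exact: odd_prod_pr. Qed.

Lemma dvdz_odd_length (x : int) :
  (n'%:Z %| x)%Z = [forall i, ((pr i ^ e i)%N%:Z %| x)%Z].
Proof. by apply: dvdn_prod_coprime => i j; exact: coprime_pr. Qed.

Lemma dvdz_expq_pred (N k : nat) : ((N%:Z %| q%:Z ^+ k - 1) = (N %| (q ^ k).-1)%N)%Z.
Proof. by rewrite -eqz_mod_dvd exp_modz_nat dvdn_pred // expn_gt0 q_gt0. Qed.

Lemma coprimez_pr (i : 'I_s) (b : nat) (x : int) :
  (0 < b)%N -> coprimez (pr i ^ b)%N%:Z x = ~~ ((pr i)%:Z %| x)%Z.
Proof. by move=> b0; rewrite -[coprimez _ _]/(coprime _ _) coprime_pexpl // prime_coprime. Qed.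

(** Once the congruences at the first [l] primes hold, [k] may still change by multiples of [L], the
    lcm of the orders met so far, without disturbing them. [primitive_root_cover] with this [L]
    settles the next prime, and its bound is [x_bound]. *)
Lemma x_cover (y : {dffun forall i : 'I_s, 'I_(e i).+1}) (c : int) :
    (forall i, (y i < e i)%N -> ~~ ((pr i)%:Z %| c)%Z) ->
  exists (x : 'I_s -> nat) (k : nat), forall i, (x i < x_bound q pr y i)%N /\
    ((pr i ^ (e i - y i))%N%:Z %| c * q%:Z ^+ k - eta i ^+ x i)%Z.
Proof.
move=> co_c.
suff H l : (l <= s)%N -> exists (x : 'I_s -> nat) (k : nat),
    forall i : 'I_s, (i < l)%N -> (x i < x_bound q pr y i)%N /\
    ((pr i ^ (e i - y i))%N%:Z %| c * q%:Z ^+ k - eta i ^+ x i)%Z.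
  have [x [k Hx]] := H s (leqnn s).
  by exists x, k => i; apply: Hx.
elim: l => [|l IH] ls; first by exists (fun=> 0%N), 0%N.
have {IH} [x [k Hx]] := IH (ltnW ls); pose i0 := Ordinal ls.
pose N := (pr i0 ^ (e i0 - y i0))%N.
pose L := (\big[lcmn/1]_(j < s | (j < i0)%N) f_ q pr y j)%N.
have [prim _] := etaP i0.
have [x0 [j [x0_lt Hx0]]] : exists x0 j : nat,
    (x0 < x_bound q pr y i0)%N /\
    (N%:Z %| (c * q%:Z ^+ k) * q%:Z ^+ (L * j) - eta i0 ^+ x0)%Z.
  have co_ck : coprimez N%:Z (c * q%:Z ^+ k).
    rewrite /N; case: (posnP (e i0 - y i0)) => [->|a0]; first by rewrite /coprimez gcd1z.
    rewrite coprimezMr coprimez_pr // co_c /=; last by rewrite -subn_gt0.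
    by apply: coprimezXr; exact: coprimeXl (pr_q i0).
  apply: primitive_root_cover => //.
  - by rewrite expn_gt0 prime_gt0.
  - by apply: coprimeXl; rewrite pr_q.
  - rewrite /N; case: (posnP (e i0 - y i0)) => [->|a0]; first by rewrite /coprimez gcd1z.
    by have [] := prim _ a0.
  - rewrite /N; case: (posnP (e i0 - y i0)) => [->|a0]; last by have [] := prim _ a0.
    by rewrite expn0 /mord /= !modz1.
exists (fun i => if i == i0 then x0 else x i), (k + L * j)%N => i.
rewrite ltnS leq_eqVlt => /orP[/eqP il|il].
  have -> : i = i0 by apply: val_inj.
  by rewrite eqxx exprD mulrA.
have ni : i != i0 by apply: contraTneq il => ->; rewrite ltnn.
rewrite (negPf ni); have [xi Hi] := Hx i il; split=> //.
have -> : c * q%:Z ^+ (k + L * j) - eta i ^+ x i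
    = (c * q%:Z ^+ k) * (q%:Z ^+ (L * j) - 1) + (c * q%:Z ^+ k - eta i ^+ x i).
  by rewrite exprD mulrBr mulr1 mulrA addrA subrK.
rewrite rpredD // dvdz_mull // dvdz_expq_pred -dvdn_mord_pr //.
by rewrite dvdn_mulr //; exact: (biglcmn_sup i).
Qed.

(** Every [eta j] with [j != i] is 1 modulo [pr i ^ e i], so only the factor at [i] survives. *)
Lemma eta_cong (i : 'I_s) (b : nat) (x : 'I_s -> nat) : (b <= e i)%N ->
  ((pr i ^ b)%N%:Z %| \prod_(j < s) eta j ^+ x j - eta i ^+ x i)%Z.
Proof.
move=> be; rewrite (bigD1 i) //= -{2}[eta i ^+ _]mulr1 -mulrBr dvdz_mull //.
have one j : j != i -> ((pr i ^ b)%N%:Z %| eta j ^+ x j - 1)%Z.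
  move=> nji; have [_ /(_ i)] := etaP j; rewrite eq_sym => /(_ nji) /eqP.
  rewrite eqz_mod_dvd => H; apply: (@dvdz_trans (eta j - 1)).
    by apply: dvdz_trans H; rewrite dvdzE /= dvdn_exp2l.
  by rewrite -{1}(expr1n _ (x j)) subrXX dvdz_mulr.
elim/big_rec: _ => [|j w nji IH]; first by rewrite subrr dvdz0.
have -> : eta j ^+ x j * w - 1 = eta j ^+ x j * (w - 1) + (eta j ^+ x j - 1).
  by ring.
by rewrite rpredD ?one // dvdz_mull.
Qed.

(** Multiplying the congruences of [x_cover] by [py_ pr y] supplies the missing [pr i ^ y i]; the
    full prime powers are coprime and combine. *)
Lemma eta_cover (y : {dffun forall i : 'I_s, 'I_(e i).+1}) (c : int) :
    (forall i, (y i < e i)%N -> ~~ ((pr i)%:Z %| c)%Z) ->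
  exists (z : Sigma q pr e) (k : nat), y_of z = y /\
    (n'%:Z %| (c * (py_ pr y)%:Z) * q%:Z ^+ k - eta_ eta z)%Z.
Proof.
move=> co_c; have [x [k Hx]] := x_cover co_c.
pose z : Sigma q pr e := Tagged
  (fun y : {dffun forall i : 'I_s, 'I_(e i).+1} =>
     {dffun forall i : 'I_s, 'I_(x_bound q pr y i)})
  [ffun i => Ordinal (proj1 (Hx i))].
exists z, k; split=> //; rewrite dvdz_odd_length; apply/forallP => i.
have Dpy : (\prod_(i < s) (pr i)%:Z ^+ y i : int) = (py_ pr y)%:Z.
  rewrite /py_ -natz natr_prod; apply: eq_bigr => j _.
  by rewrite natrX natz.
have -> : eta_ eta z = (\prod_(i < s) eta i ^+ x i) * (py_ pr y)%:Z.
  rewrite /eta_ Dpy; congr (_ * _); apply: eq_bigr => j _.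
  by rewrite /x_of /= ffunE.
set E := \prod_(i < s) _.
have -> : c * (py_ pr y)%:Z * q%:Z ^+ k - E * (py_ pr y)%:Z
    = (py_ pr y)%:Z * ((c * q%:Z ^+ k - eta i ^+ x i) - (E - eta i ^+ x i)).
  by ring.
rewrite -(subnKC (ltnSE (ltn_ord (y i)))) expnD PoszM dvdz_mul //.
  by rewrite dvdzE /= /py_ (bigD1 i) //= dvdn_mulr.
by rewrite rpredB ?eta_cong ?leq_subr //; have [] := Hx i.
Qed.

End Coverage.

(** The 2-adic binary digits of [x / n'] are the adic digits attached to [- x]. *)
Lemma bits_cover (n' k : nat) (x : int) : odd n' ->
  exists t : nat -> bool,
    (2 ^+ k %| x - n'%:Z * \sum_(i < k) (t i : nat)%:Z * 2 ^+ i)%Z.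
Proof.
move=> odd_n'; exists (adic_digit n' (- x)).
rewrite -adic_partialE -rpredN opprB addrC.
exact: adic_partial_dvd.
Qed.

(** For [b > 0] both [c] and [m] are odd and agree in the lowest bit. The free bits [t] extend the
    agreement to [2 ^ minn b v], and powers of [A] do the rest by [cycle_mod2]. *)
Lemma cover_plus (A b v n' : nat) (c m : int) : (1 < A)%N -> (4 %| A.-1)%N ->
    v = logn 2 A.-1 -> odd n' -> ~~ (2 %| m)%Z -> ((0 < b)%N -> ~~ (2 %| c)%Z) ->
  exists (t : nat -> bool) (j : nat), (2 ^+ b %| c * A%:Z ^+ j - (m + n'%:Z *
    (2 * \sum_(i < minn (b - 1) (v - 1)) (t i : nat)%:Z * 2 ^+ i)))%Z.
Proof.
move=> A1 A4 Dv odd_n' odd_m; case: b => [|b] odd_c.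
  by exists (fun=> false), 0%N; rewrite expr0 dvd1z.
have v2 : (1 < v)%N.
  by rewrite Dv -pfactor_dvdn // -subn1 subn_gt0.
have /dvdzP[x Dx] : (2 %| c - m)%Z by move: odd_m (odd_c isT); clear; lia.
set k := minn _ _; have [t Ht] := bits_cover k x odd_n'; exists t.
have Dk : minn b.+1 v = k.+1 by rewrite /k; lia.
apply: (@cycle_mod2 A b.+1 v) => //.
  set S := (X in (2 * X)); move: odd_m; have -> : n'%:Z * (2 * S) = 2 * (n'%:Z * S) by ring.
  by move: (_ * S); clear; lia.
rewrite Dk exprS; set S := (X in (2 * X)).
have -> : c - (m + n'%:Z * (2 * S)) = 2 * (x - n'%:Z * S).
  by rewrite opprD addrA Dx; ring.
by rewrite dvdz_mul.
Qed.

(** For [b > 1], since [A] is -1 modulo 4, at most one factor [A] makes [c] and [m] agree modulo 4,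
    so the free bits start at 4. The rest is done with [A ^ 2], which is 1 modulo 4 and has
    [A ^ 2 - 1] of valuation [v + 1]. *)
Lemma cover_minus (A b v n' : nat) (c m : int) : (1 < A)%N ->
    (A == 3 %[mod 4])%N -> v = logn 2 (A + 1) -> odd n' -> ~~ (2 %| m)%Z ->
    ((0 < b)%N -> ~~ (2 %| c)%Z) ->
  exists (t : nat -> bool) (j : nat), (2 ^+ b %| c * A%:Z ^+ j - (m + n'%:Z *
    (4 * \sum_(i < minn (b - 2) (v - 1)) (t i : nat)%:Z * 2 ^+ i)))%Z.
Proof.
move=> A1 A3 Dv odd_n' odd_m; case: b => [|[|b]] odd_c.
- by exists (fun=> false), 0%N; rewrite expr0 dvd1z.
- exists (fun=> false), 0%N; rewrite expr0 mulr1 expr1 mulrCA.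
  by move: (n'%:Z * _) odd_m (odd_c isT); clear; lia.
have v2 : (1 < v)%N by rewrite Dv -pfactor_dvdn ?addn1 //; move: A3; clear; lia.
have [j0 /dvdzP[x Dx]] : exists j, (4 %| c * A%:Z ^+ j - m)%Z.
  have [c4|c4] := boolP (4 %| c - m)%Z; first by exists 0%N; rewrite expr0 mulr1.
  exists 1%N; have /dvdzP[y Dy] : (4 %| A%:Z + 1)%Z by move: A3; clear; lia.
  have -> : c * A%:Z ^+ 1 - m = 4 * (y * c) - (c + m).
    by rewrite expr1 -[A%:Z](addrK 1) Dy; ring.
  by move: (y * c) c4 odd_m (odd_c isT); clear; lia.
set k := minn _ _; have [t Ht] := bits_cover k x odd_n'; exists t.
have Dk : minn b.+2 v.+1 = k.+2 by rewrite /k; lia.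
have A21 : (1 < A ^ 2)%N by rewrite -{1}(exp1n 2) ltn_exp2r.
have [|||||j Hj] := @cycle_mod2 (A ^ 2) b.+2 v.+1 (c * A%:Z ^+ j0)
    (m + n'%:Z * (4 * \sum_(i < k) (t i : nat)%:Z * 2 ^+ i)).
- exact: A21.
- rewrite dvdn_pred ?expn_gt0 ?(ltnW A1) // -modnXm (eqP A3) //.
- by rewrite logn_sqr_pred // Dv.
- set S := (X in (4 * X)); move: odd_m; have -> : n'%:Z * (4 * S) = 4 * (n'%:Z * S) by ring.
  by move: (_ * S); clear; lia.
- rewrite Dk 2!exprS; set S := (X in (4 * X)).
  have -> : c * A%:Z ^+ j0 - (m + n'%:Z * (4 * S)) = 2 * (2 * (x - n'%:Z * S)).
    by rewrite opprD addrA Dx; ring.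
  by rewrite !dvdz_mul.
exists (j0 + 2 * j)%N; move: Hj.
have -> : (A ^ 2)%N%:Z = A%:Z ^+ 2 by rewrite -natz natrX natz.
by rewrite -exprM -mulrA -exprD.
Qed.

(** * Arithmetic of the multipliers mu *)

Section Multipliers.

Variables (q s : nat) (pr e : 'I_s -> nat).
Hypotheses (q_gt1 : (1 < q)%N) (odd_q : odd q).
Hypotheses (pr_prime : forall i, prime (pr i)) (pr_odd : forall i, odd (pr i)).
Hypotheses (pr_inj : injective pr) (pr_q : forall i, coprime (pr i) q).
Variables (e0 : nat) (eta : 'I_s -> int).
Hypothesis etaP : primitive_root_system pr e eta.

Let q_gt0 : (0 < q)%N. Proof. exact: ltnW. Qed.
Local Notation n' := (odd_length pr e).

(** Common shape of the two families: [T] is a sum of bits for [mu_plus] and twice such a sum for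
    [mu_minus]. *)
Definition mu_of (z : Sigma q pr e) (d : nat) (T : int) : int :=
  eta_ eta z + n'%:Z * (adic_U n' (eta_ eta z) d + 2 ^+ d.+1 * T).

Lemma mu_plusE (z : Sigma q pr e) (d : nat) (t : {ffun 'I_(s_plus e0 z d) -> bool}) :
  mu_plus eta t = mu_of z d (\sum_j (t j : nat)%:Z * 2 ^+ j).
Proof.
rewrite /mu_plus /mu_of mulr_sumr; congr (_ + _ * (_ + _)).
by apply: eq_bigr => j _; rewrite addnS -addSn exprD mulrCA.
Qed.

Lemma mu_minusE (z : Sigma q pr e) (d : nat) (t : {ffun 'I_(s_minus e0 z d) -> bool}) :
  mu_minus eta t = mu_of z d (2 * \sum_j (t j : nat)%:Z * 2 ^+ j).
Proof.
rewrite /mu_minus /mu_of !mulr_sumr; congr (_ + _ * (_ + _)).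
apply: eq_bigr => j _.
by rewrite addn1 !addnS -!addSn exprD exprS; ring.
Qed.

Section FixedIndex.
Variables (z : Sigma q pr e) (d : nat).
Local Notation y := (y_of z).

Definition cofactor_odd_length : nat := (\prod_(i < s) pr i ^ (e i - y i))%N.
Local Notation R := cofactor_odd_length.

Lemma odd_lengthE : n' = (py_ pr y * R)%N.
Proof.
rewrite /py_ /R -big_split; apply: eq_bigr => i _ /=.
by rewrite -expnD subnKC // -ltnS.
Qed.

Lemma eta_E : eta_ eta z = (\prod_(i < s) eta i ^+ x_of z i) * (py_ pr y)%:Z.
Proof.
rewrite /eta_; congr (_ * _); rewrite /py_ -natz natr_prod; apply: eq_bigr => j _.
by rewrite natrX natz.
Qed.

Lemma py_gt0 : (0 < py_ pr y)%N.
Proof. by rewrite prodn_gt0 // => i; rewrite expn_gt0 prime_gt0. Qed.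

Lemma mu_ofE (T : int) : mu_of z d T = (py_ pr y)%:Z *
  (\prod_(i < s) eta i ^+ x_of z i
   + R%:Z * (adic_U n' (eta_ eta z) d + 2 ^+ d.+1 * T)).
Proof. by rewrite /mu_of {1}odd_lengthE {1}eta_E PoszM; ring. Qed.

(** The term in [T] is divisible by [2 ^ d.+1], so the 2-adic valuation is the one fixed by
    [adic_U_exact]. If [y i < e i] then [pr i] divides [R], so the cofactor of [py_] is modulo
    [pr i] a power of [eta i], a unit. *)
Lemma mu_of_exact (T : int) : exists m : int,
  [/\ mu_of z d T = m * (2 ^ d * py_ pr y)%N%:Z, ~~ (2 %| m)%Z &
      forall i, (y i < e i)%N -> ~~ ((pr i)%:Z %| m)%Z].
Proof.
have odd_py : odd (py_ pr y) by exact: odd_prod_pr.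
have [d_dvd d_ndvd] := adic_U_exact (eta_ eta z) d (odd_odd_length e pr_odd).
have muE : mu_of z d T = (eta_ eta z + n'%:Z * adic_U n' (eta_ eta z) d)
    + 2 ^+ d.+1 * (n'%:Z * T) by rewrite /mu_of; ring.
set c := \prod_(i < s) eta i ^+ x_of z i
   + R%:Z * (adic_U n' (eta_ eta z) d + 2 ^+ d.+1 * T).
have cE : mu_of z d T = (py_ pr y)%:Z * c := mu_ofE T.
have : (2 ^+ d %| mu_of z d T)%Z.
  by rewrite muE rpredD // exprS -mulrA mulrCA dvdz_mulr.
rewrite cE Gauss_dvdzr; last first.
  by rewrite -exp2z; apply: coprimeXl; rewrite coprime2n.
case/dvdzP=> m Dm; exists m; split.
- by rewrite Dm PoszM exp2z; ring.
- apply: contra d_ndvd => /dvdzP[m' Dm'].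
  have -> : eta_ eta z + n'%:Z * adic_U n' (eta_ eta z) d
      = mu_of z d T - 2 ^+ d.+1 * (n'%:Z * T) by rewrite muE addrK.
  have -> : mu_of z d T = 2 ^+ d.+1 * (m' * (py_ pr y)%:Z).
    by rewrite cE Dm Dm' exprS; ring.
  by rewrite -mulrBr dvdz_mulr.
- move=> i ye; have : ~~ ((pr i)%:Z %| c)%Z.
    have dR : ((pr i)%:Z %| R%:Z)%Z.
      rewrite dvdzE /= /R (bigD1 i) //= dvdn_mulr // -{1}(expn1 (pr i)).
      by rewrite dvdn_exp2l // subn_gt0.
    have e_gt0 : (0 < e i)%N by apply: leq_ltn_trans ye.
    have := eta_cong etaP (fun j => x_of z j : nat) e_gt0; rewrite expn1 => H.
    have [/(_ 1%N isT) [co _] _] := etaP i.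
    move: co; rewrite coprimez_pr //; apply: contra => dvd_c.
    have : ((pr i)%:Z %| eta i ^+ x_of z i)%Z.
      rewrite -[eta i ^+ _](subKr (\prod_(j < s) eta j ^+ x_of z j)) rpredB //.
      have -> : \prod_(j < s) eta j ^+ x_of z j
          = c - R%:Z * (adic_U n' (eta_ eta z) d + 2 ^+ d.+1 * T).
        by rewrite /c addrK.
      by rewrite rpredB // dvdz_mulr.
    by rewrite !dvdzE abszX /= Euclid_dvdX // => /andP[].
  by apply: contra => H; rewrite Dm dvdz_mulr.
Qed.

End FixedIndex.
End Multipliers.

Section MultiplierCoverage.

Variables (q s : nat) (pr e : 'I_s -> nat).
Hypotheses (q_gt1 : (1 < q)%N) (odd_q : odd q).
Hypotheses (pr_prime : forall i, prime (pr i)) (pr_odd : forall i, odd (pr i)).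
Hypotheses (pr_inj : injective pr) (pr_q : forall i, coprime (pr i) q).
Variables (e0 : nat) (eta : 'I_s -> int).
Hypothesis etaP : primitive_root_system pr e eta.

Let q_gt0 : (0 < q)%N. Proof. exact: ltnW. Qed.
Local Notation n' := (odd_length pr e).

(** The division in [mut_plus] and [mut_minus] is thus exact, and coprimality keeps the
    corresponding power of a primitive root of unity primitive. *)
Lemma mut_exact (z : Sigma q pr e) (d : nat) (T : int) :
  let mu := mu_of eta z d T in let D := (2 ^ d * py_ pr (y_of z))%N in
  mu = (mu %/ D%:Z)%Z * D%:Z /\
  forall b, coprimez (2 ^ b * cofactor_odd_length z)%N%:Z (mu %/ D%:Z)%Z.
Proof.
move=> mu D; have [m [Dmu odd_m pr_m]] := mu_of_exact pr_prime pr_odd etaP z d T.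
have D_neq0 : D%:Z != 0.
  by rewrite eqz_nat -lt0n muln_gt0 expn_gt0 py_gt0.
have -> : (mu %/ D%:Z)%Z = m by rewrite /mu Dmu mulzK.
split=> // b; rewrite -[coprimez _ _]/(coprime _ `|m|%N) coprimeMl.
apply/andP; split.
  by apply: coprimeXl; rewrite coprime2n -[odd _]negbK -dvdn2.
rewrite /cofactor_odd_length; apply big_ind => [|a c ca cc|i _].
- exact: coprime1n.
- by rewrite coprimeMl ca.
have [ye|] := ltnP (y_of z i) (e i); last first.
  by rewrite -subn_eq0 => /eqP->; exact: coprime1n.
by apply: coprimeXl; rewrite prime_coprime //; exact: pr_m.
Qed.

(** Take [y i] to be the valuation of [c] at [pr i], capped at [e i]: below the cap the quotient of
    [c] by [py_] is prime to [pr i], as [eta_cover] requires. *)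
Lemma gamma_cover (c : nat) : (0 < c)%N ->
  exists (z : Sigma q pr e) (k : nat),
    (n'%:Z %| c%:Z * q%:Z ^+ k - eta_ eta z)%Z /\ (py_ pr (y_of z) %| c)%N.
Proof.
move=> c0.
pose y : {dffun forall i : 'I_s, 'I_(e i).+1} :=
  [ffun i => inord (minn (e i) (logn (pr i) c))].
have yE i : y i = minn (e i) (logn (pr i) c) :> nat.
  by rewrite ffunE inordK // ltnS geq_minl.
have py_c : (py_ pr y %| c)%N.
  rewrite dvdn_prod_coprime => [|i j nij]; last exact: coprime_pr.
  by apply/forallP => i; rewrite pfactor_dvdn // yE geq_minr.
have [z [k [Dy Hz]]] : exists (z : Sigma q pr e) (k : nat), y_of z = y /\
    (n'%:Z %| ((c %/ py_ pr y)%N%:Z * (py_ pr y)%:Z) * q%:Z ^+ k - eta_ eta z)%Z.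
  apply: eta_cover => // i ye; apply/negP => H.
  have : (pr i ^ (y i).+1 %| c)%N.
    rewrite -[X in (_ %| X)%N](divnK py_c) expnS dvdn_mul //.
    by rewrite /py_ (bigD1 i) //= dvdn_mulr.
  rewrite pfactor_dvdn //; move: ye; rewrite yE.
  by rewrite gtn_min ltnn /= => lt; rewrite (minn_idPr (ltnW lt)) ltnn.
exists z, k; split; last by rewrite Dy.
by rewrite -PoszM divnK in Hz.
Qed.

(** Adjusting the 2-part by a power of [q ^ tau] is harmless modulo [n']: [n'] is [py_] times the
    cofactor, [py_] divides [c], and [q ^ tau] is 1 modulo the cofactor. *)
Lemma lift_cover (z : Sigma q pr e) (d k j c : nat) (C m T : int) :
    (d <= e0)%N -> (n'%:Z %| c%:Z * q%:Z ^+ k - eta_ eta z)%Z ->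
    (py_ pr (y_of z) %| c)%N -> c%:Z * q%:Z ^+ k = 2 ^+ d * C ->
    eta_ eta z + n'%:Z * adic_U n' (eta_ eta z) d = 2 ^+ d * m ->
    (2 ^+ (e0 - d) %| C * (q ^ tau_ q pr (y_of z))%N%:Z ^+ j
        - (m + n'%:Z * (2 * T)))%Z ->
  ((2 ^ e0 * n')%N%:Z %|
     c%:Z * q%:Z ^+ (k + tau_ q pr (y_of z) * j) - mu_of eta z d T)%Z.
Proof.
set A := (q ^ _)%N => de Hn /dvdnP[c' Dc] DC Dm H2.
have DA : q%:Z ^+ (tau_ q pr (y_of z) * j) = A%:Z ^+ j.
  by rewrite exprM /A -[(q ^ _)%N%:Z]natz natrX natz.
have odd_n' : odd n' := odd_odd_length e pr_odd.
rewrite PoszM Gauss_dvdz; last by apply: coprimeXl; rewrite coprime2n.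
apply/andP; split.
  have -> : (2 ^ e0)%N%:Z = 2 ^+ d * 2 ^+ (e0 - d).
    by rewrite -exprD subnKC // exp2z.
  have -> : c%:Z * q%:Z ^+ (k + tau_ q pr (y_of z) * j) - mu_of eta z d T
      = 2 ^+ d * (C * A%:Z ^+ j - (m + n'%:Z * (2 * T))).
    rewrite exprD mulrA DC DA /mu_of mulrDr addrA Dm exprS.
    by move: (A%:Z ^+ j) => u; ring.
  by rewrite dvdz_mul.
have -> : c%:Z * q%:Z ^+ (k + tau_ q pr (y_of z) * j) - mu_of eta z d T
    = c%:Z * (q%:Z ^+ (tau_ q pr (y_of z) * j) - 1) * q%:Z ^+ k
      + (c%:Z * q%:Z ^+ k - eta_ eta z)
      - n'%:Z * (adic_U n' (eta_ eta z) d + 2 ^+ d.+1 * T).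
  rewrite /mu_of exprD; move: (q%:Z ^+ (_ * j)) (q%:Z ^+ k) => u w.
  by rewrite opprD; move: (n'%:Z * _) => x; ring.
rewrite rpredB ?dvdz_mulr // rpredD // dvdz_mulr //.
rewrite Dc (odd_lengthE z) [(c' * _)%N]mulnC !PoszM -mulrA dvdz_mul // dvdz_mull //.
rewrite dvdz_expq_pred // /cofactor_odd_length dvdn_prod_coprime; last first.
  by move=> i1 i2; exact: coprime_pr.
apply/forallP => i; rewrite -dvdn_mord_pr // dvdn_mulr //.
exact: (biglcmn_sup i).
Qed.

Lemma mu_cover (c : nat) : (0 < c)%N ->
  (exists (z : Sigma q pr e) (d : 'I_e0.+1)
      (t : {ffun 'I_(s_plus e0 z d) -> bool}) (k : nat),
    Sigma_plus z /\
    ((2 ^ e0 * n')%N%:Z %| c%:Z * q%:Z ^+ k - mu_plus eta t)%Z) \/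
  (exists (z : Sigma q pr e) (d : 'I_e0.+1)
      (t : {ffun 'I_(s_minus e0 z d) -> bool}) (k : nat),
    Sigma_minus z /\
    ((2 ^ e0 * n')%N%:Z %| c%:Z * q%:Z ^+ k - mu_minus eta t)%Z).
Proof.
move=> c0; have [z [k [Hz py_c]]] := gamma_cover c0.
(* [d] is the 2-adic valuation of [c] capped at [e0]; at the cap the remaining congruence is modulo
   1, below it the cofactor [C] is odd. *)
have d_lt : (minn e0 (logn 2 c) < e0.+1)%N by rewrite ltnS geq_minl.
pose d := Ordinal d_lt; have de : (d <= e0)%N := geq_minl _ _.
have odd_n' : odd n' := odd_odd_length e pr_odd.
have [C DC] : exists C : int, c%:Z * q%:Z ^+ k = 2 ^+ d * C.
  have : (2 ^+ d %| c%:Z)%Z.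
    by rewrite -exp2z dvdzE !absz_nat pfactor_dvdn // geq_minr.
  by case/dvdzP=> x ->; exists (x * q%:Z ^+ k); rewrite mulrAC mulrC.
have odd_C : (0 < e0 - d)%N -> ~~ (2 %| C)%Z.
  rewrite subn_gt0 => lt_d; apply/negP => /dvdzP[x Dx].
  have : (2 ^+ d.+1 %| c%:Z * q%:Z ^+ k)%Z.
    by rewrite DC Dx exprSr [x * 2]mulrC mulrA dvdz_mulr.
  rewrite Gauss_dvdzl; last first.
    by apply: coprimezXl; apply: coprimezXr; rewrite -[coprimez _ _]/(coprime 2 q) coprime2n.
  rewrite -exp2z dvdzE !absz_nat pfactor_dvdn //; move: lt_d; rewrite /d /=.
  by rewrite gtn_min ltnn /= => lt; rewrite (minn_idPr (ltnW lt)) ltnn.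
have [/dvdzP[m Dm] d_ndvd] := adic_U_exact (eta_ eta z) d odd_n'.
rewrite [m * _]mulrC in Dm.
have odd_m : ~~ (2 %| m)%Z.
  apply: contra d_ndvd => /dvdzP[x Dx].
  by rewrite Dm Dx exprSr [x * 2]mulrC mulrA dvdz_mulr.
have t_gt0 := tau_gt0 q pr (y_of z).
have A1 : (1 < q ^ tau_ q pr (y_of z))%N 
  by rewrite -{1}(exp1n (tau_ q pr (y_of z))) ltn_exp2r.
have [plus|] := boolP (Sigma_plus z).
  left; have A4 : (4 %| (q ^ tau_ q pr (y_of z)).-1)%N.
    by rewrite dvdn_pred // ltnW.
  have Dv : v_plus q pr (y_of z) = logn 2 (q ^ tau_ q pr (y_of z)).-1.
    by rewrite /v_plus subn1.
  have [t [j Hj]] := cover_plus A1 A4 Dv odd_n' odd_m odd_C.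
  exists z, d, [ffun i : 'I_(s_plus e0 z d) => t i].
  exists (k + tau_ q pr (y_of z) * j)%N; split=> //.
  rewrite mu_plusE; apply: (lift_cover de Hz py_c DC Dm).
  by under eq_bigr => i _ do rewrite ffunE.
move=> nplus; right; have minus : Sigma_minus z.
  have : odd (q ^ tau_ q pr (y_of z)) by rewrite oddX odd_q orbT.
  by rewrite /Sigma_minus; move: nplus; rewrite /Sigma_plus; clear; lia.
have [t [j Hj]] := cover_minus A1 minus (erefl (v_minus q pr (y_of z))) odd_n' odd_m odd_C.
exists z, d, [ffun i : 'I_(s_minus e0 z d) => t i].
exists (k + tau_ q pr (y_of z) * j)%N; split=> //.
rewrite mu_minusE; apply: (lift_cover de Hz py_c DC Dm).
rewrite [2 * (2 * _)]mulrA.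
by under eq_bigr => i _ do rewrite ffunE.
Qed.

End MultiplierCoverage.

(** * Polynomials of Frobenius orbits *)

Lemma prod_sub_expand (R : comNzRingType) (w : nat) (a : 'I_w -> R)
    (Y : {poly R}) :
  \prod_(u < w) (Y - (a u)%:P) =
  \sum_(i < w.+1) ((-1) ^+ (w - i) *
     \sum_(U : {set 'I_w} | #|U| == (w - i)%N) \prod_(u in U) a u) *: Y ^+ i.
Proof.
under eq_bigr => u _ do rewrite addrC.
rewrite bigA_distr.
(* The sets [J] of factors contributing their constant term are grouped by the resulting power
   [w - #|J|] of [Y]. *)
rewrite (partition_big (fun J : {set 'I_w} => inord (w - #|J|) : 'I_w.+1) xpredT) //=.
apply: eq_bigr => i _; rewrite mulr_sumr scaler_suml.
have cardJ (J : {set 'I_w}) : (#|J| <= w)%N.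
  by rewrite -[X in (_ <= X)%N]card_ord max_card.
rewrite (eq_bigl (fun U : {set 'I_w} => #|U| == (w - i)%N)) => [|J]; last first.
  rewrite -val_eqE /= inordK ?ltnS ?leq_subr //.
  by apply/eqP/eqP => [<-|->]; rewrite subKn ?cardJ // -ltnS.
apply: eq_bigr => J /eqP cJ; rewrite (bigID (mem J)) /=.
rewrite (eq_bigr (fun u => - (a u)%:P)) => [|u ->] //.
rewrite [X in _ * X](eq_bigr (fun=> Y)) => [|u /negPf->] //.
rewrite prodrN -rmorph_prod prodr_const cJ.
have -> : #|[pred u | u \notin J]| = i.
  apply: (@addnI (w - i)%N); rewrite subnK -1?ltnS // -{1}cJ.
  by rewrite -[RHS](card_ord w) -(cardC (mem J)).
rewrite -mul_polyC rmorphM rmorphXn rmorphN1 //.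
Qed.

Lemma MpolyE (K : fieldType) (q : nat) (zeta : nat -> K) (w r h : nat) (mut : int) :
  Mpoly q zeta w r h mut
    = \prod_(u < w) ('X^h - (zeta r ^ (mut * q%:Z ^+ u))%:P).
Proof.
by rewrite prod_sub_expand; apply: eq_bigr => i _; rewrite exprM.
Qed.

Lemma expz_dvd (K : fieldType) (z : K) (r : nat) (i j : int) : z != 0 ->
  z ^+ r = 1 -> (r%:Z %| i - j)%Z -> z ^ i = z ^ j.
Proof.
move=> z0 zr /dvdzP[x Dx]; rewrite -[i](subrK j) Dx expfzDr // [x * _]mulrC.
by rewrite -exprz_exp -exprnP zr exp1rz mul1r.
Qed.

(* The proof qR is an argument so that the morphism structure of frobenius qR
   can be inferred from the term. *)
Definition frobenius (R : comNzRingType) (q : nat)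
  (qR : [pchar R].-nat q) (x : R) : R := x ^+ q.

Section FrobeniusMorphism.
Variables (R : comNzRingType) (q : nat) (qR : [pchar R].-nat q).

Fact frobenius_zmod_morphism : zmod_morphism (frobenius qR).
Proof.
move=> x y; rewrite /frobenius; apply/(canRL (addrK _)).
by rewrite -exprDn_pchar // subrK.
Qed.
Fact frobenius_monoid_morphism : monoid_morphism (frobenius qR).
Proof. by split=> [|x y]; rewrite /frobenius ?expr1n ?exprMn. Qed.

HB.instance Definition _ :=
  GRing.isZmodMorphism.Build R R (frobenius qR) frobenius_zmod_morphism.
HB.instance Definition _ :=
  GRing.isMonoidMorphism.Build R R (frobenius qR) frobenius_monoid_morphism.
End FrobeniusMorphism.

(** * Descent of polynomials from [K] to [F] *)

Section Descent.

Variables (F : finFieldType) (K : fieldType) (iota : {rmorphism F -> K}).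
Local Notation q := #|F|.
Hypothesis qK : [pchar K].-nat q.

Lemma frobenius_map_poly (G : {poly F}) :
  map_poly (frobenius qK) (map_poly iota G) = map_poly iota G.
Proof.
rewrite -map_poly_comp; apply: eq_map_poly => x /=.
by rewrite /frobenius -rmorphXn /= expf_card.
Qed.

Lemma root_frobenius (G : {poly F}) (x : K) (k : nat) :
  root (map_poly iota G) x -> root (map_poly iota G) (x ^+ (q ^ k)).
Proof.
move=> Gx; elim: k => [|k IH]; first by rewrite expn0 expr1.
rewrite expnSr exprM -[_ ^+ q]/(frobenius qK (x ^+ (q ^ k))).
by rewrite -[map_poly iota G]frobenius_map_poly fmorph_root.
Qed.

(** ['X^q - 'X] is the product of the ['X - b] over all [b] in [F], so its root [c] is the image of
    some [b]. *)
Lemma fixed_frobenius (c : K) : c ^+ q = c -> exists b : F, iota b = c.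
Proof.
move=> cq; have := congr1 (fun f => (map_poly iota f).[c]) (finField_genPoly F).
rewrite rmorphB rmorph_prod /= map_polyXn map_polyX !hornerE cq subrr.
move/esym/eqP; rewrite horner_prod prodf_seq_eq0 => /hasP[b _].
by rewrite rmorphB /= map_polyX map_polyC !hornerE subr_eq0 => /eqP->; exists b.
Qed.

(** Preimages are picked coefficient by coefficient; the default 0 occurs only for coefficients
    outside the image of [iota]. *)
Definition descend (f : {poly K}) : {poly F} :=
  \poly_(i < size f) odflt 0 [pick b | iota b == f`_i].

Lemma descendK (f : {poly K}) : map_poly (frobenius qK) f = f ->
  map_poly iota (descend f) = f.
Proof.
move=> ff; apply/polyP => i; rewrite coef_map coef_poly.
case: ltnP => [lt|le]; last first.
  by rewrite [RHS]nth_default //; exact: (rmorph0 iota).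
have [|c Dc] := @fixed_frobenius f`_i; first by rewrite -{2}ff coef_map.
by case: pickP => [c' /eqP//|/(_ c)]; rewrite Dc eqxx.
Qed.

End Descent.

Section OrbitPolynomial.

Variables (F : finFieldType) (K : fieldType) (iota : {rmorphism F -> K}).
Local Notation q := #|F|.
Hypothesis qK : [pchar K].-nat q.
Variables (zeta : nat -> K) (w r h : nat) (mut : int).
Hypotheses (w_gt0 : (0 < w)%N) (h_gt0 : (0 < h)%N) (r_gt0 : (0 < r)%N).
Hypothesis zeta_r : zeta r ^+ r = 1.
Hypothesis r_dvd : (r %| (q ^ w).-1)%N.
Local Notation M := (Mpoly q zeta w r h mut).

Let q_gt0 : (0 < q)%N. Proof. by rewrite (cardD1 0). Qed.

Let zr_neq0 : zeta r != 0.
Proof. by apply: contra_eq_neq zeta_r => ->; rewrite expr0n gtn_eqF // eq_sym oner_eq0. Qed.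

Lemma expz_mod_w (k : nat) :
  zeta r ^ (mut * q%:Z ^+ k) = zeta r ^ (mut * q%:Z ^+ (k %% w)).
Proof.
apply: (expz_dvd zr_neq0 zeta_r).
rewrite {1}(divn_eq k w) addnC exprD -mulrBr -{2}[q%:Z ^+ _]mulr1 -mulrBr.
rewrite !dvdz_mull // -eqz_mod_dvd exp_modz_nat mulnC expnM -modnXm.
by move: r_dvd; rewrite dvdn_pred ?expn_gt0 ?q_gt0 // => /eqP->; rewrite modnXm exp1n.
Qed.

(** Frobenius sends the factor of index [u] to that of index [u + 1], and the factor of index [w] is
    that of index 0, so the product is fixed. *)
Lemma Mpoly_descend : map_poly iota (descend iota M) = M.
Proof.
apply: (@descendK _ _ iota qK); rewrite MpolyE rmorph_prod /=.
pose g k := 'X^h - (zeta r ^ (mut * q%:Z ^+ k))%:P.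
rewrite (eq_bigr (fun u : 'I_w => g u.+1)) => [|u _]; last first.
  rewrite rmorphB /= map_polyXn map_polyC /= /frobenius [_ ^+ q]exprnP.
  by rewrite exprz_exp -mulrA -exprSr.
have : g w = g 0%N by rewrite /g expz_mod_w modnn.
case: (w) w_gt0 => // w' _ gw; rewrite big_ord_recr big_ord_recl /= gw mulrC.
by [].
Qed.

Lemma Mpoly_monic : M \is monic.
Proof. by rewrite MpolyE monic_prod // => u _; rewrite monicXnsubC. Qed.

Lemma size_Mpoly : size M = (w * h).+1.
Proof.
have gm (c : K) : 'X^h - c%:P \is monic by exact: monicXnsubC.
rewrite MpolyE; elim: (w) => [|k IH]; first by rewrite big_ord0 size_poly1.
rewrite big_ord_recr /= size_monicM ?monic_neq0 //; last first.
  by apply: monic_prod => u _.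
by rewrite IH size_XnsubC // mulSn addnS /= addSn addnC.
Qed.

Variable xi : K.
Hypothesis xi_prim : (r * h).-primitive_root xi.
Hypothesis xi_h : xi ^+ h = zeta r ^ mut.
Hypothesis order : forall j, (r * h %| (q ^ j).-1)%N -> (w * h %| j)%N.
Hypothesis co_q : coprime (r * h) q.

Lemma root_Mpoly (k : nat) : root M (xi ^+ (q ^ k)).
Proof.
rewrite MpolyE rootE horner_prod.
have kw : (k %% w < w)%N by rewrite ltn_mod.
rewrite (bigD1 (Ordinal kw)) //= !hornerE -exprM mulnC exprM xi_h -expz_mod_w.
by rewrite [_ ^+ (q ^ k)]exprnP exprz_exp -natz natrX natz subrr mul0r.
Qed.

(** [q ^ l - q ^ k] is [q ^ k] times [q ^ (l - k) - 1], and [q ^ k] is prime to the order of [xi];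
    equality would make [w * h] divide the smaller positive number [l - k]. *)
Lemma xi_frobenius_inj (k l : nat) : (k < l < w * h)%N ->
  xi ^+ (q ^ k) != xi ^+ (q ^ l).
Proof.
case/andP=> kl lw; rewrite (eq_prim_root_expr xi_prim) eq_sym.
rewrite eqn_mod_dvd; last by rewrite leq_pexp2l ?q_gt0 ?(ltnW kl).
rewrite -(subnKC (ltnW kl)) expnD -{2}[(q ^ k)%N]muln1 -mulnBr.
rewrite Gauss_dvdr ?coprimeXr // subn1; apply/negP => /order /dvdn_leq.
by rewrite subn_gt0 => /(_ kl); rewrite leqNgt (leq_ltn_trans (leq_subr _ _)).
Qed.

Lemma uniq_roots_frobenius_orbit :
  uniq_roots [seq xi ^+ (q ^ k) | k <- seq.iota 0 (w * h)].
Proof.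
rewrite uniq_rootsE map_inj_in_uniq ?iota_uniq // => k l.
rewrite !mem_iota !add0n /= => kw lw; apply: contra_eq.
by rewrite neq_ltn => /orP[kl|lk]; [|rewrite eq_sym];
  apply: xi_frobenius_inj; apply/andP.
Qed.

(** The degree [w * h] equals the number of distinct conjugates of [xi] listed, and all of them are
    roots. *)
Lemma Mpoly_prod :
  M = \prod_(x <- [seq xi ^+ (q ^ k) | k <- seq.iota 0 (w * h)]) ('X - x%:P).
Proof.
rewrite -[RHS]scale1r -[X in X *: _](eqP Mpoly_monic); apply: all_roots_prod_XsubC.
- by rewrite size_Mpoly size_map size_iota.
- by apply/allP => x /mapP[k _ ->]; exact: root_Mpoly.
exact: uniq_roots_frobenius_orbit.
Qed.

Lemma Mpoly_dvd (G : {poly F}) :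
  root (map_poly iota G) xi -> M %| map_poly iota G.
Proof.
move=> Gxi; rewrite Mpoly_prod; apply: uniq_roots_dvdp.
  by apply/allP => x /mapP[k _ ->]; exact: root_frobenius.
exact: uniq_roots_frobenius_orbit.
Qed.

End OrbitPolynomial.

(** * Cyclic codes as ideals *)

Section Codes.

Variables (F : finFieldType) (m : nat).
Hypothesis m_gt0 : (0 < m)%N.
Local Notation Pm := ('X^m - 1 : {poly F}).

Lemma Xn_sub_1_monic : Pm \is monic.
Proof. by rewrite -[1]/(1%:P) monicXnsubC. Qed.

Lemma size_Xn_sub_1 : size Pm = m.+1.
Proof. by rewrite -[1]/(1%:P) size_XnsubC. Qed.

(** [mk_monic] replaces a constant or non-monic modulus by ['X]; [m > 0] excludes this. *)
Lemma mk_monic_Xn_sub_1 : mk_monic Pm = Pm.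
Proof. by rewrite /mk_monic size_Xn_sub_1 Xn_sub_1_monic ltnS m_gt0. Qed.

Lemma in_qpoly_eq (f g : {poly F}) :
  in_qpoly Pm f = in_qpoly Pm g <-> Pm %| f - g.
Proof.
have modE (u : {poly F}) : in_qpoly Pm u = u %% Pm :> {poly F}.
  by rewrite (Pdiv.IdomainMonic.modpE Xn_sub_1_monic) /= mk_monic_Xn_sub_1.
have -> : Pm %| f - g = (f %% Pm == g %% Pm).
  by rewrite /dvdp modpD modpN subr_eq0.
split=> [E|/eqP E]; first by rewrite -!modE E.
by apply/val_inj; exact: (etrans (modE f) (etrans E (esym (modE g)))).
Qed.

Lemma generated_byP (C : {vspace 'rV[F]_m}) (G : {poly F}) :
  generated_by C G <->
  (forall c, c \in C <-> exists A : {poly F}, Pm %| rVpoly c - A * G).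
Proof.
suff E (c : 'rV[F]_m) : (exists a : {poly %/ Pm}, in_qpoly Pm (rVpoly c) = a * in_qpoly Pm G)
    <-> exists A : {poly F}, Pm %| rVpoly c - A * G.
  split=> H c; first exact: iff_trans (H c) (E c).
  exact: iff_trans (H c) (iff_sym (E c)).
split=> [[a Ha]|[A /in_qpoly_eq]]; last first.
  by rewrite in_qpolyM => ->; exists (in_qpoly Pm A).
exists a; apply/in_qpoly_eq; rewrite in_qpolyM Ha; congr (_ * _).
by apply/val_inj/esym/in_qpoly_small/size_mk_monic.
Qed.

(** Multiplication by ['X] moves the last letter to degree [m]; subtracting that letter times
    ['X^m - 1] returns it to degree 0. *)
Lemma rVpoly_shift (c : 'rV[F]_m) :
  Pm %| rVpoly (cyclic_shift c) - 'X * rVpoly c.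
Proof.
case: m m_gt0 c => // k _ c.
suff -> : rVpoly (cyclic_shift c) = 'X * rVpoly c - (c 0 ord_max)%:P * ('X^(k.+1) - 1).
  by rewrite addrAC subrr sub0r dvdpNr dvdp_mull.
apply/polyP => -[|i]; rewrite coefB coefXM coefCM coefB coefXn coef1 /=.
  rewrite sub0r mulrBr mulr0 sub0r mulr1 opprK.
  rewrite (coef_rVpoly_ord _ (ord0 : 'I_k.+1)) mxE; congr (c 0 _).
  by apply: val_inj; rewrite /= modn_small.
rewrite subr0 eqSS; have [ik|ki] := ltnP i k.
  have i1 : (i.+1 < k.+1)%N by []; have i0 : (i < k.+1)%N by apply: ltnW.
  rewrite (coef_rVpoly_ord _ (Ordinal i1)) (coef_rVpoly_ord _ (Ordinal i0)) mxE.
  rewrite ltn_eqF // mulr0 subr0; congr (c 0 _).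
  by apply: val_inj; rewrite /= modnDr modn_small.
rewrite nth_default; last by rewrite (leq_trans (size_poly _ _)).
move: ki; rewrite leq_eqVlt => /orP[/eqP<-|ki].
  have -> : (rVpoly c)`_k = c 0 ord_max := coef_rVpoly_ord c ord_max.
  by rewrite eqxx mulr1 subrr.
rewrite nth_default ?gtn_eqF ?mulr0 ?subr0 //.
by rewrite (leq_trans (size_poly _ _)).
Qed.

Lemma rVpoly_modp (u : {poly F}) :
  rVpoly (poly_rV (u %% Pm) : 'rV[F]_m) = u %% Pm.
Proof.
rewrite poly_rV_K // -ltnS -size_Xn_sub_1 ltn_modp monic_neq0 //.
exact: Xn_sub_1_monic.
Qed.

(** The ideal is realised as a subspace, the image of the linear map sending [a] to [a * G] modulo
    ['X^m - 1]. *)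
Lemma ideal_code (G : {poly F}) :
  exists C : {vspace 'rV[F]_m}, cyclic_code C /\ generated_by C G.
Proof.
pose f (a : 'rV[F]_m) : 'rV[F]_m := poly_rV ((rVpoly a * G) %% Pm).
have lin_f : linear f.
  move=> k a b; rewrite /f linearP /= mulrDl modpD -scalerAl modpZl.
  by rewrite linearP.
pose fL : {linear 'rV[F]_m -> 'rV[F]_m} := HB.pack f
  (GRing.isLinear.Build F 'rV[F]_m 'rV[F]_m *:%R f lin_f).
have memC c : c \in limg (linfun fL) <-> exists A : {poly F}, Pm %| rVpoly c - A * G.
  split=> [/memv_imgP[a _ ->]|[A HA]].
    exists (rVpoly a); rewrite lfunE /= rVpoly_modp -dvdpNr opprB.
    by rewrite /dvdp modpD modpN modp_id subrr.
  have -> : c = linfun fL (poly_rV (A %% Pm)).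
    rewrite lfunE /= /f rVpoly_modp -[LHS]rVpolyK; congr poly_rV.
    move: HA; rewrite /dvdp modpD modpN subr_eq0 => /eqP.
    rewrite modp_small; last by rewrite size_Xn_sub_1 ltnS size_poly.
    by move=> ->; rewrite mulrC -modp_mul mulrC.
  by rewrite memv_img ?memvf.
exists (limg (linfun fL)); split; last by apply/generated_byP.
move=> c /memC[A HA]; apply/memC; exists ('X * A).
have -> : rVpoly (cyclic_shift c) - 'X * A * G
  = (rVpoly (cyclic_shift c) - 'X * rVpoly c) + 'X * (rVpoly c - A * G).
  by rewrite mulrBr mulrA addrA subrK.
by apply: dvdp_add; [exact: rVpoly_shift | exact: dvdp_mull].
Qed.

(** The polynomials whose class lies in [C] form an ideal, the shift being multiplication by ['X].
    By Bezout it contains the gcd of its elements, which is then made monic. *)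
Lemma code_generator (C : {vspace 'rV[F]_m}) : cyclic_code C ->
  exists G : {poly F}, [/\ G \is monic, G %| Pm & generated_by C G].
Proof.
move=> cycC; pose I (f : {poly F}) := (poly_rV (f %% Pm) : 'rV[F]_m) \in C.
have I_rV (c : 'rV[F]_m) : I (rVpoly c) = (c \in C).
  by rewrite /I modp_small ?rVpolyK // size_Xn_sub_1 ltnS size_poly.
have I_D f g : I f -> I g -> I (f + g).
  by rewrite /I modpD linearD; exact: memvD.
have I_Z a f : I f -> I (a *: f) by rewrite /I modpZl linearZ; exact: memvZ.
have I_mod f g : Pm %| f - g -> I f = I g.
  by rewrite /dvdp modpD modpN subr_eq0 /I => /eqP->.
have I_X f : I f -> I ('X * f).
  move=> If; set c := (poly_rV (f %% Pm) : 'rV[F]_m).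
  have : I (rVpoly (cyclic_shift c)) by rewrite I_rV; apply: cycC.
  rewrite (I_mod _ ('X * rVpoly c)) ?rVpoly_shift // (I_mod _ ('X * f)) //.
  by rewrite /c rVpoly_modp -mulrBr dvdp_mull // /dvdp modpD modpN modp_id subrr.
have I_M A f : I f -> I (A * f).
  move=> If; elim/poly_ind: A => [|A a IH].
    by rewrite mul0r /I mod0p linear0 mem0v.
  rewrite mulrDl mul_polyC [A * 'X]mulrC -mulrA.
  by apply: I_D; [apply: I_X | apply: I_Z].
have I_Pm : I Pm by rewrite /I modpp linear0 mem0v.
(* Starting the gcd at [Pm] makes it divide [Pm], so it is nonzero even for the zero code. *)
pose G0 := \big[@gcdp F/Pm]_(c : 'rV[F]_m | c \in C) rVpoly c.
have I_G0 : I G0.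
  rewrite /G0; apply big_ind => // [f g If Ig|c]; last by rewrite I_rV.
  have [[u v] /eqpP[[a b] /andP[/= a0 b0] E]] := Bezoutp f g.
  have -> : gcdp f g = (b^-1 * a) *: (u * f + v * g).
    by rewrite -scalerA E scalerA mulVf ?scale1r.
  by apply: I_Z; apply: I_D; apply: I_M.
have G0_Pm : G0 %| Pm.
  rewrite /G0; elim/big_rec: _ => // c g _ IH.
  by apply: dvdp_trans IH; exact: dvdp_gcdr.
have G0_C c : c \in C -> G0 %| rVpoly c.
  move=> cC; have := mem_index_enum c; rewrite /G0.
  elim: (index_enum _) => // x s IH; rewrite inE big_cons.
  case/orP=> [/eqP<-|/IH H]; first by rewrite cC dvdp_gcdl.
  by case: ifP => // _; exact: dvdp_trans (dvdp_gcdr _ _) H.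
have G0_neq0 : G0 != 0.
  by apply: contraTneq G0_Pm => ->; rewrite dvd0p monic_neq0 ?Xn_sub_1_monic.
have lc0 : lead_coef G0 != 0 by rewrite lead_coef_eq0.
exists ((lead_coef G0)^-1 *: G0); split.
- by rewrite monicE lead_coefZ mulVf.
- by rewrite dvdpZl ?invr_eq0.
apply/generated_byP => c; split=> [/G0_C/dvdpP[A DA]|[A HA]].
  exists (lead_coef G0 *: A); rewrite DA -scalerAl -scalerAr scalerA divff //.
  by rewrite scale1r subrr dvdp0.
by rewrite -I_rV (I_mod _ _ HA); apply/I_M/I_Z.
Qed.

End Codes.

(** * Factorization of the divisors of (X^n - 1)^B *)

(** Factors [M i] are peeled off by induction on the size. Distinct indices may carry the same
    polynomial: each exponent is bounded on its own, because [M i ^ Om i] divides [H]. *)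
Lemma monic_prod_exponents (F : fieldType) (I : finType) (P : pred I)
    (M : I -> {poly F}) (H : {poly F}) (B : nat) :
    (forall i, P i -> M i \is monic) -> (forall i, P i -> (1 < size (M i))%N) ->
    (forall G, G %| H -> (1 < size G)%N -> exists2 i, P i & M i %| G) ->
    (forall i k, P i -> M i ^+ k %| H -> (k <= B)%N) ->
  forall G, G \is monic -> G %| H ->
  exists Om : I -> 'I_B.+1, G = \prod_(i | P i) M i ^+ Om i.
Proof.
move=> M_monic M_size M_dvd M_bound G G_monic G_dvd.
suff [Om DG] : exists Om : I -> nat, G = \prod_(i | P i) M i ^+ Om i.
  exists (fun i => inord (Om i)); rewrite DG; apply: eq_bigr => i Pi.
  rewrite inordK // ltnS (M_bound i) //; apply: dvdp_trans G_dvd.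
  by rewrite DG (bigD1 i) //= dvdp_mulr.
move: {2}(size G) (leqnn (size G)) => k.
elim: k G G_monic G_dvd => [|k IH] G G_monic G_dvd.
  by rewrite leqn0 size_poly_eq0 (negPf (monic_neq0 G_monic)).
have [G1|G1] := ltnP 1 (size G); last first.
  exists (fun=> 0%N); rewrite big1 //.
  by move: G_monic; rewrite (size1_polyC G1) monicE lead_coefC => /eqP->.
have [i Pi /dvdpP[G' DG]] := M_dvd G G_dvd G1.
have G'_monic : G' \is monic by rewrite -(monicMr _ (M_monic i Pi)) -DG.
rewrite DG size_Mmonic ?monic_neq0 ?M_monic // => le_k.
have [||Om DG'] := IH G' G'_monic.
- by apply: dvdp_trans G_dvd; rewrite DG dvdp_mulr.
- by move: le_k (M_size i Pi); case: (size (M i)) => [|[|l]] //=; lia.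
exists (fun j => if j == i then (Om j).+1 else Om j).
rewrite DG' (bigD1 i) //= [RHS](bigD1 i) //= eqxx exprSr mulrAC; congr (_ * _ * _).
by apply: eq_bigr => j /andP[_ /negPf->].
Qed.

Lemma prim_root_neq0 (K : fieldType) (N : nat) (z : K) :
  N.-primitive_root z -> z != 0.
Proof.
move=> prim_z; apply: contra_eq_neq (prim_expr_order prim_z) => ->.
by rewrite expr0n gtn_eqF ?(prim_order_gt0 prim_z) // eq_sym oner_eq0.
Qed.

Lemma prim_expz (K : fieldType) (N : nat) (z : K) (x : int) :
  N.-primitive_root z -> coprimez N%:Z x -> N.-primitive_root (z ^ x).
Proof.
move=> prim_z co; have N0 := prim_order_gt0 prim_z.
have [k Dk] : exists k : nat, (x %% N%:Z)%Z = k%:Z.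
  by exists `|(x %% N%:Z)%Z|%N; rewrite gez0_abs // modz_ge0 // -lt0n.
have -> : z ^ x = z ^+ k.
  rewrite exprnP -Dk; apply: (expz_dvd (prim_root_neq0 prim_z) (prim_expr_order prim_z)).
  by rewrite {1}(divz_eq x N%:Z) addrK dvdz_mull.
rewrite (prim_root_exp_coprime _ prim_z) coprime_sym.
by rewrite -[coprime _ _]/(coprimez N%:Z k%:Z) -Dk /coprimez gcdz_modr.
Qed.

Lemma mup_Xn_sub_1 (K : fieldType) (n : nat) (z x : K) :
  n.-primitive_root z -> (mup x ('X^n - 1) <= 1)%N.
Proof.
move=> prim_z; rewrite -(factor_Xn_sub_1 prim_z).
rewrite -(big_map (fun i => z ^+ i) xpredT (fun y => 'X - y%:P)).
rewrite mu_prod_XsubC count_uniq_mem ?leq_b1 // map_inj_in_uniq ?iota_uniq //.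
move=> i j; rewrite !mem_index_iota /= => i_n j_n /eqP.
by rewrite (eq_prim_root_expr prim_z) !modn_small // => /eqP.
Qed.

Lemma mup_exp (K : fieldType) (x : K) (f : {poly K}) (k : nat) : f != 0 ->
  mup x (f ^+ k) = (k * mup x f)%N.
Proof.
move=> f0; elim: k => [|k IH]; first by rewrite mupNroot // /root hornerE oner_eq0.
by rewrite exprS mupM ?expf_neq0 // IH mulSn.
Qed.

(** * Minimal polynomials of roots of unity over [F] *)

Section OrbitData.

Variables (F : finFieldType) (K : closedFieldType) (iota : {rmorphism F -> K}).
Local Notation q := #|F|.
Hypothesis qK : [pchar K].-nat q.
Variables (zeta : nat -> K).
Hypothesis hzeta : compatible_roots q zeta.

(** In other words, [descend iota M] is the minimal polynomial of [xi] over [F]. *)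
Record orbit_poly (M : {poly K}) (xi : K) : Prop := OrbitPoly {
  orbit_descend : map_poly iota (descend iota M) = M;
  orbit_monic : M \is monic;
  orbit_size : (1 < size M)%N;
  orbit_root : root M xi;
  orbit_dvd : forall G : {poly F}, root (map_poly iota G) xi -> M %| map_poly iota G }.

(** Compatibility rewrites the root as [zeta (r * h) ^ mut], which is primitive of order [r * h] and
    whose [h]-th power is [zeta r ^ mut]. *)
Lemma orbit_polyP (n w r h D : nat) (mut : int) : coprime n q -> (0 < w)%N ->
    n = (r * h * D)%N -> (0 < n)%N -> coprimez (r * h)%N%:Z mut ->
    (r %| (q ^ w).-1)%N ->
    (forall j, (r * h %| (q ^ j).-1)%N -> (w * h %| j)%N) ->
  orbit_poly (Mpoly q zeta w r h mut) (zeta n ^ (mut * D%:Z)).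
Proof.
move=> co_n w0 Dn n0 co_mut r_dvd order; rewrite Dn in co_n n0 *.
move: (n0); rewrite !muln_gt0 => /andP[/andP[r0 h0] D0].
have co_N : coprime (r * h) q by move: co_n; rewrite coprimeMl => /andP[].
have co_r : coprime r q by move: co_N; rewrite coprimeMl => /andP[].
have [prim compat] := hzeta.
have zr : zeta r ^+ r = 1 by apply: prim_expr_order; apply: prim.
set xi := _ ^ _; have Dxi : xi = zeta (r * h)%N ^ mut.
  have := compat (r * h)%N (r * h * D)%N co_n (dvdn_mulr _ (dvdnn _)).
  rewrite mulKn ?muln_gt0 ?r0 // => <-.
  by rewrite exprnP exprz_exp mulrC.
have xi_prim : (r * h).-primitive_root xi.
  by rewrite Dxi prim_expz ?prim.
have xi_h : xi ^+ h = zeta r ^ mut.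
  rewrite -(compat r (r * h)%N) ?dvdn_mulr // mulKn // Dxi.
  by rewrite [_ ^+ h]exprnP [_ ^+ h]exprnP !exprz_exp mulrC.
split.
- exact: Mpoly_descend.
- exact: Mpoly_monic.
- by rewrite size_Mpoly // ltnS muln_gt0 w0.
- have := root_Mpoly w0 r0 zr r_dvd xi_h 0; rewrite expn0 expr1; exact.
- move=> G; exact: (Mpoly_dvd qK w0 h0 r0 zr r_dvd xi_prim xi_h order co_N).
Qed.

End OrbitData.

(** * Factorization over the whole index set *)

Section Assembly.

Variables (F : finFieldType) (K : closedFieldType) (iota : {rmorphism F -> K}).
Local Notation q := #|F|.
Hypotheses (qK : [pchar K].-nat q) (q_gt1 : (1 < q)%N) (odd_q : odd q).
Variables (zeta : nat -> K) (hzeta : compatible_roots q zeta).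
Variables (s : nat) (pr e : 'I_s -> nat) (e0 : nat).
Hypotheses (pr_prime : forall i, prime (pr i)) (pr_odd : forall i, odd (pr i)).
Hypotheses (pr_inj : injective pr) (pr_q : forall i, coprime (pr i) q).
Variable eta : 'I_s -> int.
Hypothesis etaP : primitive_root_system pr e eta.

Local Notation n := (2 ^ e0 * odd_length pr e)%N.

Lemma length_gt0 : (0 < n)%N.
Proof. by rewrite muln_gt0 expn_gt0 /= odd_gt0 ?odd_odd_length. Qed.

Lemma coprime_length_q : coprime n q.
Proof.
rewrite coprimeMl; apply/andP; split; first by apply: coprimeXl; rewrite coprime2n.
rewrite /odd_length; apply big_ind => [|a b ca cb|i _]; first exact: coprime1n.
  by rewrite coprimeMl ca.
exact: coprimeXl.
Qed.

Lemma lengthE (z : Sigma q pr e) (d : nat) : (d <= e0)%N ->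
  n = (2 ^ (e0 - d) * cofactor_odd_length z * (2 ^ d * py_ pr (y_of z)))%N.
Proof. by move=> de; rewrite (odd_lengthE z) -{1}(subnK de) expnD; ring. Qed.

Lemma plus_orbit (z : Sigma q pr e) (d : 'I_e0.+1)
    (t : {ffun 'I_(s_plus e0 z d) -> bool}) : Sigma_plus z ->
  orbit_poly iota (M_plus eta zeta t) (zeta n ^ mu_plus eta t).
Proof.
move=> plus; have de : (d <= e0)%N by rewrite -ltnS.
have [rh r_dvd order] :=
  plus_orders q_gt1 odd_q pr_prime pr_odd pr_inj pr_q plus de.
rewrite /M_plus /mut_plus mu_plusE; set T := \sum_j _.
have [Dmu co_mut] := mut_exact pr_prime pr_odd etaP z d T.
rewrite {2}Dmu; apply: (orbit_polyP iota qK hzeta coprime_length_q) => //.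
- exact: omega_gt0.
- by rewrite rh -lengthE.
- exact: length_gt0.
- by rewrite rh co_mut.
Qed.

Lemma minus_orbit (z : Sigma q pr e) (d : 'I_e0.+1)
    (t : {ffun 'I_(s_minus e0 z d) -> bool}) : Sigma_minus z ->
  orbit_poly iota (M_minus eta zeta t) (zeta n ^ mu_minus eta t).
Proof.
move=> minus; have de : (d <= e0)%N by rewrite -ltnS.
have [rh r_dvd order] :=
  minus_orders q_gt1 odd_q pr_prime pr_odd pr_inj pr_q minus de.
rewrite /M_minus /mut_minus mu_minusE; set T := 2 * _.
have [Dmu co_mut] := mut_exact pr_prime pr_odd etaP z d T.
rewrite {2}Dmu; apply: (orbit_polyP iota qK hzeta coprime_length_q) => //.
- by rewrite /omega'_; case: ifP => _; rewrite ?muln_gt0 omega_gt0.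
- by rewrite rh -lengthE.
- exact: length_gt0.
- by rewrite rh co_mut.
Qed.

(** Each triple [z], [d], [t] becomes one element of a finite type, so that [monic_prod_exponents]
    can run over a single index set. *)
Definition plus_index : finType :=
  {z : Sigma q pr e & {d : 'I_e0.+1 & {ffun 'I_(s_plus e0 z d) -> bool}}}.
Definition minus_index : finType :=
  {z : Sigma q pr e & {d : 'I_e0.+1 & {ffun 'I_(s_minus e0 z d) -> bool}}}.

Definition valid_index (i : plus_index + minus_index) : bool :=
  match i with
  | inl j => Sigma_plus (tag j)
  | inr j => Sigma_minus (tag j)
  end.

Definition M_index (i : plus_index + minus_index) : {poly K} :=
  match i with
  | inl j => M_plus eta zeta (tagged (tagged j))
  | inr j => M_minus eta zeta (tagged (tagged j))
  end.

Definition mu_index (i : plus_index + minus_index) : int :=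
  match i with
  | inl j => mu_plus eta (tagged (tagged j))
  | inr j => mu_minus eta (tagged (tagged j))
  end.

Lemma index_orbit (i : plus_index + minus_index) : valid_index i ->
  orbit_poly iota (M_index i) (zeta n ^ mu_index i).
Proof. by case: i => j; [exact: plus_orbit | exact: minus_orbit]. Qed.

Lemma index_cover (c : nat) : (0 < c)%N ->
  exists i k, valid_index i /\ (n%:Z %| c%:Z * q%:Z ^+ k - mu_index i)%Z.
Proof.
move/(mu_cover q_gt1 odd_q pr_prime pr_odd pr_inj pr_q e0 etaP).
case=> -[z [d [t [k [Hz Hmu]]]]].
  pose j : plus_index := Tagged _
    (Tagged (fun d : 'I_e0.+1 => {ffun 'I_(s_plus e0 z d) -> bool}) t).
  by exists (inl j), k.
pose j : minus_index := Tagged _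
  (Tagged (fun d : 'I_e0.+1 => {ffun 'I_(s_minus e0 z d) -> bool}) t).
by exists (inr j), k.
Qed.

Lemma generatorE (B : nat) (Om : plus_index + minus_index -> 'I_B.+1) :
  generator eta zeta
    (fun z d t => Om (inl (Tagged
       (fun z => {d : 'I_e0.+1 & {ffun 'I_(s_plus e0 z d) -> bool}})
       (Tagged (fun d : 'I_e0.+1 => {ffun 'I_(s_plus e0 z d) -> bool}) t))))
    (fun z d t => Om (inr (Tagged
       (fun z => {d : 'I_e0.+1 & {ffun 'I_(s_minus e0 z d) -> bool}})
       (Tagged (fun d : 'I_e0.+1 => {ffun 'I_(s_minus e0 z d) -> bool}) t))))
  = \prod_(i | valid_index i) M_index i ^+ Om i.
Proof.
rewrite /generator big_sumType /=; congr (_ * _).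
  under eq_bigr => z _ do rewrite sig_big_dep /=.
  rewrite sig_big_dep /=; apply: eq_big => [i|[z [d t]] _] //=.
  by rewrite andbT.
under eq_bigr => z _ do rewrite sig_big_dep /=.
rewrite sig_big_dep /=; apply: eq_big => [i|[z [d t]] _] //=.
by rewrite andbT.
Qed.

Lemma generator_descends (B : nat) (Op : exponents_plus q pr e e0 B)
    (Om : exponents_minus q pr e e0 B) :
  exists G : {poly F}, map_poly iota G = generator eta zeta Op Om.
Proof.
have prodP (I : finType) (P : pred I) (M : I -> {poly K}) :
    (forall i, P i -> exists G : {poly F}, map_poly iota G = M i) ->
    exists G : {poly F}, map_poly iota G = \prod_(i | P i) M i.
  move=> H; apply big_ind => //; first by exists 1; rewrite rmorph1.
  by move=> f g [Gf <-] [Gg <-]; exists (Gf * Gg); rewrite rmorphM.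
have [|Gp DGp] := prodP _ (@Sigma_plus q s pr e) (fun z => \prod_(d < e0.+1)
   \prod_(t : {ffun 'I_(s_plus e0 z d) -> bool}) M_plus eta zeta t ^+ Op z d t).
  move=> z plus; apply: (prodP) => d _; apply: (prodP) => t _.
  by exists (descend iota (M_plus eta zeta t) ^+ Op z d t);
     rewrite rmorphXn /= (orbit_descend (plus_orbit t plus)).
have [|Gm DGm] := prodP _ (@Sigma_minus q s pr e) (fun z => \prod_(d < e0.+1)
   \prod_(t : {ffun 'I_(s_minus e0 z d) -> bool}) M_minus eta zeta t ^+ Om z d t).
  move=> z minus; apply: (prodP) => d _; apply: (prodP) => t _.
  by exists (descend iota (M_minus eta zeta t) ^+ Om z d t);
     rewrite rmorphXn /= (orbit_descend (minus_orbit t minus)).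
by exists (Gp * Gm); rewrite rmorphM /= DGp DGm.
Qed.

Lemma divisor_generator (B : nat) (G : {poly F}) :
    G \is monic -> G %| ('X^n - 1) ^+ B ->
  exists (Op : exponents_plus q pr e e0 B) (Om : exponents_minus q pr e e0 B),
    map_poly iota G = generator eta zeta Op Om.
Proof.
move=> G_monic G_dvd.
have prim_n : n.-primitive_root (zeta n) by apply: hzeta.1; exact: coprime_length_q.
have mapH : map_poly iota (('X^n - 1) ^+ B) = ('X^n - 1) ^+ B.
  by rewrite rmorphXn rmorphB /= map_polyXn rmorph1.
have Xn_neq0 : 'X^n - 1 != 0 :> {poly K}.
  by rewrite monic_neq0 // -[1]/(1%:P) monicXnsubC // length_gt0.
have [||||Om DG] := @monic_prod_exponents F _ valid_index
    (fun i => descend iota (M_index i)) (('X^n - 1) ^+ B) B _ _ _ _ G G_monic G_dvd.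
- move=> i /index_orbit[Mi mon _ _ _]; move: mon; rewrite -{1}Mi.
  by rewrite map_monic.
- by move=> i /index_orbit[Mi _ sz _ _]; move: sz; rewrite -{1}Mi size_map_poly.
- move=> G' G'_dvd G'_size.
  have [x Gx] : exists x, root (map_poly iota G') x.
    by apply/closed_rootP; rewrite size_map_poly gtn_eqF.
  have xn : x ^+ n = 1.
    move: G'_dvd; rewrite -(dvdp_map iota) mapH => /dvdpP[A DA].
    have : root (('X^n - 1) ^+ B) x by rewrite DA rootM Gx orbT.
    by rewrite /root !hornerE expf_eq0 subr_eq0 => /andP[_ /eqP].
  (* [index_cover] works with valuations of the exponent and needs it positive, so 1 is written as
     [zeta n ^+ n]. *)
  have [c c0 Dx] : exists2 c, (0 < c)%N & x = zeta n ^+ c.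
    have [i ->] := prim_rootP prim_n xn.
    have [i0|i0] := posnP i; last by exists i.
    by exists n; rewrite ?length_gt0 // i0 expr0 prim_expr_order.
  have [i [k [Pi Hmu]]] := index_cover c0; exists i => //.
  have [Mi _ _ _ M_dvd] := index_orbit Pi.
  rewrite -(dvdp_map iota) Mi M_dvd //.
  (* The congruence makes the root attached to [i] a Frobenius conjugate of [x], hence a root of
     [G']. *)
  have -> : zeta n ^ mu_index i = x ^+ (q ^ k).
    rewrite Dx -exprM exprnP PoszM.
    have -> : (q ^ k)%N%:Z = q%:Z ^+ k by rewrite -natz natrX natz.
    exact/esym/(expz_dvd (prim_root_neq0 prim_n) (prim_expr_order prim_n)).
  exact: root_frobenius.
(* The root of [M_index i] has multiplicity at least [k] in the [k]-th power, and at most [B] in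
   [('X^n - 1) ^+ B] because ['X^n - 1] has simple roots. *)
- move=> i k Pi; rewrite -(dvdp_map iota) mapH rmorphXn /=.
  have [-> _ _ Mx _] := index_orbit Pi; set x := _ ^ _ in Mx => M_dvd.
  have : ('X - x%:P) ^+ k %| ('X^n - 1) ^+ B.
    by apply: dvdp_trans M_dvd; rewrite dvdp_exp2r // dvdp_XsubCl.
  rewrite -mup_geq ?expf_neq0 // mup_exp // => /leq_trans; apply.
  by rewrite -[X in (_ <= X)%N]muln1 leq_mul2l (mup_Xn_sub_1 _ prim_n) orbT.
do 2!eexists; apply: etrans (esym (generatorE Om)).
rewrite DG rmorph_prod; apply: eq_bigr => i Pi.
by rewrite rmorphXn /= (orbit_descend (index_orbit Pi)).
Qed.

End Assembly.

Theorem theorem5p2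
  (p a q v : nat) (hp : prime p) (hp_odd : odd p)
  (ha : (0 < a)%N) (hq : q = (p ^ a)%N)
  (F : finFieldType) (hF : #|F| = q)
  (K : closedFieldType) (iota : {rmorphism F -> K}) (hK : integralRange iota)
  (zeta : nat -> K) (hzeta : compatible_roots q zeta)
  (s : nat) (pr e : 'I_s -> nat) (e0 : nat)
  (hpr : forall i, prime (pr i)) (hpr_odd : forall i, odd (pr i))
  (hpr_p : forall i, pr i != p) (hpr_inj : injective pr)
  (he0 : (0 < e0)%N) (he : forall i, (0 < e i)%N)
  (eta : 'I_s -> int) (heta : primitive_root_system pr e eta)
  (m : nat) (hm : m = (p ^ v * (2 ^ e0 * odd_length pr e))%N) :
  (forall (Op : exponents_plus q pr e e0 (p ^ v))
          (Om : exponents_minus q pr e e0 (p ^ v)),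
     exists (G : {poly F}) (C : {vspace 'rV[F]_m}),
       [/\ map_poly iota G = generator eta zeta Op Om,
           cyclic_code C & generated_by C G]) /\
  (forall C : {vspace 'rV[F]_m}, cyclic_code C ->
     exists (Op : exponents_plus q pr e e0 (p ^ v))
            (Om : exponents_minus q pr e e0 (p ^ v)) (G : {poly F}),
       map_poly iota G = generator eta zeta Op Om /\ generated_by C G).
Proof.
have pF : p \in [pchar F] by apply: card_finPcharP hp; rewrite hF hq.
have pK : p \in [pchar K] := rmorph_pchar iota pF.
have q_gt1 : (1 < q)%N by rewrite hq -(exp1n a) ltn_exp2r // prime_gt1.
have odd_q : odd q by rewrite hq oddX hp_odd orbT.
have pr_q i : coprime (pr i) q.
  by rewrite hq; apply: coprimeXr; rewrite prime_coprime // dvdn_prime2.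
have qK : [pchar K].-nat q by rewrite hq pnatX pnatE ?pK.
rewrite -hF in q_gt1 odd_q pr_q qK hzeta *.
have m_gt0 : (0 < m)%N by rewrite hm muln_gt0 expn_gt0 prime_gt0 // length_gt0.
split=> [Op Om|C /(code_generator m_gt0)[G [G_monic G_dvd C_G]]].
  have [G DG] := generator_descends iota qK q_gt1 odd_q hzeta hpr hpr_odd
    hpr_inj pr_q heta Op Om.
  by have [C [C_cyc C_G]] := ideal_code m_gt0 G; exists G, C.
have [|Op [Om DG]] := divisor_generator iota qK q_gt1 odd_q hzeta
   (e0 := e0) hpr hpr_odd hpr_inj pr_q heta (B := (p ^ v)%N) G_monic.
  (* In characteristic [p] raising to the power [p ^ v] is additive, so a divisor of ['X^m - 1] is a
     divisor of a power of ['X^n - 1]. *)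
  suff <- : 'X^m - 1 = ('X^(2 ^ e0 * odd_length pr e) - 1) ^+ (p ^ v) :> {poly F} by [].
  have pP : p \in [pchar {poly F}] := rmorph_pchar (@polyC F) pF.
  have pvP : [pchar {poly F}].-nat (p ^ v)%N by rewrite pnatX pnatE ?pP.
  have := rmorphB (frobenius pvP) 'X^(2 ^ e0 * odd_length pr e) 1.
  by rewrite /= /frobenius expr1n -exprM [(_ * p ^ v)%N]mulnC -hm => ->.
by exists Op, Om, G.
Qed.
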